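(* Let $k$ be a fixed positive integer. There is an algorithm that, given a hypergraph $\mathcal{H}=(V,E)$ of dimension at most $k$ and maximum degree $\Delta$, decides whether the dual hypergraph $\mathcal{H}^d$ is conformal, in time $\mathcal{O}(|E||V|^{2}\Delta^2+|E||V|^{k})$.
   Context: A hypergraph is a pair $\mathcal{H}=(V,E)$ with $V$ a finite nonempty set of vertices and $E$ a set of subsets of $V$ (hyperedges) such that every vertex lies in some hyperedge; it is given by the list of its hyperedges. The dimension of $\mathcal{H}$ is $\max_{e\in E}|e|$, the degree of a vertex is the number of hyperedges containing it, and $\Delta$ is the maximum degree. A transversal of $\mathcal{H}$ is a set of vertices intersecting every hyperedge; it is minimal if no proper subset is a transversal. The dual hypergraph $\mathcal{H}^d$ has vertex set $V$ and its hyperedges are exactly the minimal transversals of $\mathcal{H}$. A hypergraph is conformal if for every set $U$ of vertices such that every pair of vertices of $U$ is contained in some hyperedge, $U$ itself is contained in some hyperedge. *)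

(* Defs.v *)
From mathcomp Require Import all_boot.
Set Implicit Arguments.
Unset Strict Implicit.
Unset Printing Implicit Defensive.

Section Hypergraphs.
Variable V : finType.
Implicit Types (E : {set {set V}}) (T U e : {set V}) (v : V).

(* A family of hyperedges E on the vertex set V; the empty hyperedge is not
   excluded. *)
Definition is_hypergraph E : bool := (0 < #|V|) && (cover E == [set: V]).

Definition dimension E : nat := \max_(e in E) #|e|.

Definition degree E v : nat := #|[set e in E | v \in e]|.

Definition max_degree E : nat := \max_(v : V) degree E v.

Definition is_transversal_of E T : bool := [forall e in E, T :&: e != set0].

Definition dual_hypergraph E : {set {set V}} :=
  [set T | minset (is_transversal_of E) T].

(* Defined for arbitrary families: when E has comparable hyperedges, its dual
   need not cover V.  A pair consists of two distinct vertices, so a vertex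
   lying in no hyperedge refutes conformality (take U to be its singleton). *)
Definition conformal E : bool :=
  [forall U : {set V},
     [forall u in U, forall v in U,
        (u != v) ==> [exists e in E, [set u; v] \subset e]]
     ==> [exists e in E, U \subset e]].

(* es lists the hyperedges of E, each exactly once and each as a list of its
   vertices without repetition, in an arbitrary order. *)
Definition edge_list E (es : seq (seq V)) : Prop :=
  [/\ all uniq es, uniq [seq [set:: s] | s <- es]
    & E =i [seq [set:: s] | s <- es]].

(* The words |V|, |E|, followed for each hyperedge by its size and the numbers
   of its vertices. *)
Definition encode (num : V -> 'I_#|V|) (es : seq (seq V)) : seq nat :=
  [:: #|V|, size es &
      flatten [seq size s :: [seq val (num v) | v <- s] | s <- es]].

End Hypergraphs.

(* Random-access machine with unit cost and bounded words, programmed with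
   structured control flow.  The arguments of type nat are register numbers,
   except for the literal of Const. *)
Inductive binop := Add | Sub | Mul.

Inductive test := Eq of nat & nat | Lt of nat & nat.

Inductive prog :=
  | Skip
  | Const of nat & nat          (* r_x := n *)
  | Op of binop & nat & nat & nat (* r_x := r_y op r_z *)
  | Fetch of nat & nat          (* r_x := ram[r_y] *)
  | Store of nat & nat          (* ram[r_x] := r_y *)
  | Seq of prog & prog
  | If of test & prog & prog
  | While of test & prog.

Record state := State { reg : nat -> nat; ram : nat -> nat }.

Definition upd (f : nat -> nat) (i x : nat) : nat -> nat :=
  fun j => if j == i then x else f j.

Definition set_reg (s : state) (i x : nat) : state :=
  State (upd (reg s) i x) (ram s).

Definition set_ram (s : state) (i x : nat) : state :=
  State (reg s) (upd (ram s) i x).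

(* Sub is truncated at 0. *)
Definition eval_op (o : binop) (a b : nat) : nat :=
  match o with Add => a + b | Sub => a - b | Mul => a * b end.

Definition eval_test (b : test) (s : state) : bool :=
  match b with
  | Eq x y => reg s x == reg s y
  | Lt x y => reg s x < reg s y
  end.

(* exec W p s t s': started in s, the program p halts in s' after t elementary
   steps, where every word it produces is smaller than W.  An overflowing
   program has no execution. *)
Inductive exec (W : nat) : prog -> state -> nat -> state -> Prop :=
  | exec_skip s : exec W Skip s 1 s
  | exec_const x n s : n < W -> exec W (Const x n) s 1 (set_reg s x n)
  | exec_op o x y z s :
      eval_op o (reg s y) (reg s z) < W ->
      exec W (Op o x y z) s 1 (set_reg s x (eval_op o (reg s y) (reg s z)))
  | exec_load x y s :
      exec W (Fetch x y) s 1 (set_reg s x (ram s (reg s y)))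
  | exec_store x y s :
      exec W (Store x y) s 1 (set_ram s (reg s x) (reg s y))
  | exec_seq p q s1 s2 s3 t u :
      exec W p s1 t s2 -> exec W q s2 u s3 -> exec W (Seq p q) s1 (t + u) s3
  | exec_if_true b p q s s' t :
      eval_test b s -> exec W p s t s' -> exec W (If b p q) s t.+1 s'
  | exec_if_false b p q s s' t :
      ~~ eval_test b s -> exec W q s t s' -> exec W (If b p q) s t.+1 s'
  | exec_while_true b p s1 s2 s3 t u :
      eval_test b s1 -> exec W p s1 t s2 -> exec W (While b p) s2 u s3 ->
      exec W (While b p) s1 (t + u).+1 s3
  | exec_while_false b p s :
      ~~ eval_test b s -> exec W (While b p) s 1 s.

Lemma exec_det W p s t1 s1 t2 s2 :
  exec W p s t1 s1 -> exec W p s t2 s2 -> t1 = t2 /\ s1 = s2.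
Proof.
move=> e1; elim: e1 t2 s2 => {p s t1 s1};
  intros; match goal with H : exec _ _ _ _ _ |- _ = _ /\ _ => inversion H end;
  subst; try by [split];
  try (match goal with
    H1 : is_true (eval_test ?b ?s), H2 : is_true (~~ eval_test ?b ?s) |- _ =>
      by rewrite H1 in H2
    end);
  repeat match goal with
    IH : forall t u, exec W ?p ?s t u -> _, H : exec W ?p ?s ?t ?u |- _ =>
      case: (IH _ _ H) => ? ?; clear H IH; subst
    end; by [].
Qed.

Definition init_state (input : seq nat) : state :=
  State (fun=> 0) (nth 0 input).

(* Within time t, and with words of O(log N) bits for inputs of N words (words
   smaller than N ^ c), p writes to register 0 the truth value of the answer. *)
Definition decides (p : prog) (c : nat) (input : seq nat) (answer : bool)
    (t : nat) : Prop :=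
  exists (t' : nat) (s : state),
    [/\ exec (size input ^ c) p (init_state input) t' s,
        t' <= t & reg s 0 = nat_of_bool answer].

(* Main.v *)
Require Import Defs.
From mathcomp Require Import all_boot zify.
Set Implicit Arguments.
Unset Strict Implicit.
Unset Printing Implicit Defensive.

(** Call two vertices near when they are equal or lie in a common minimal
transversal, and let H have dimension at most k.  Then the dual of H is
conformal if and only if
  (a) for every hyperedge e and all pairwise near x_1, ..., x_k, some vertex
      of e is near all of the x_i, and
  (b) every vertex w lies in a hyperedge none of whose other vertices is near w.
Condition (a) says that maximal cliques of the nearness graph are transversals,
since a hyperedge e missed by a maximal clique is refuted by picking in the
clique one vertex not near each vertex of e.  Condition (b) provides private
hyperedges, so that these cliques are minimal transversals.  Conversely, if (b)
fails at w, the vertices near w, except w, form a transversal, and a minimal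
transversal inside it together with w is a clique contained in no minimal
transversal.

Distinct u and v are near if and only if there are hyperedges e containing u
but not v and f containing v but not u such that no hyperedge is contained in
e :|: f minus u and v.  Looping over u, v, e, f and only then over all
hyperedges takes time O(|E||V|^2 Delta^2), and (a), (b) are then tested with the
table of nearness in time O(|E||V|^k).

Nearness, (a) and (b) are first-order formulas with quantifiers bounded by the
vertices, the hyperedges, or the vertices of a hyperedge; such formulas are
compiled to nested loops. *)

(** * Conformality of the dual hypergraph *)

Section DualConformality.
Variables (V : finType) (E : {set {set V}}).
Implicit Types (e f g T U : {set V}) (u v w x : V).

Definition cooccur u v : bool :=
  [exists T in dual_hypergraph E, [set u; v] \subset T].

Definition near u v : bool := (u == v) || cooccur u v.

Lemma near_refl u : near u u.
Proof. by rewrite /near eqxx. Qed.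

Lemma near_sym u v : near u v = near v u.
Proof. by rewrite /near /cooccur eq_sym setUC. Qed.

(** By minimality [T :\ u] misses some hyperedge; since [T] meets it, it does so in [u] only. *)
Lemma dual_private T u :
  T \in dual_hypergraph E -> u \in T -> exists2 e, e \in E & T :&: e = [set u].
Proof.
rewrite inE => /minsetP[/forall_inP trT minT] uT.
have /negP : ~ is_transversal_of E (T :\ u).
  by move=> /minT/(_ (subsetDl _ _))/setP/(_ u); rewrite !inE eqxx uT.
rewrite /is_transversal_of negb_forall_in => /exists_inP[e eE].
rewrite negbK => /eqP Te0.
exists e => //; apply/eqP; rewrite eqEsubset sub1set.
have sub : T :&: e \subset [set u].
  apply/subsetP => x; rewrite !inE => /andP[xT xe]; apply/negPn/negP => xu.
  by move/setP/(_ x): Te0; rewrite !inE xu xT xe.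
rewrite sub; have /set0Pn[x xTe] := trT e eE.
by have := subsetP sub x xTe; rewrite inE => /eqP <-.
Qed.

(* A set of vertices with private hyperedges lies in a minimal transversal as
   soon as the union of these, with the set itself removed, contains no
   hyperedge: take a minimal transversal inside the complement. *)
Lemma cooccurP u v : u != v ->
  reflect (exists e f, [/\ e \in E, f \in E, (u \in e) && (v \notin e),
             (v \in f) && (u \notin f)
           & forall g, g \in E -> ~~ (g \subset (e :|: f) :\: [set u; v])])
          (cooccur u v).
Proof.
move=> uv; apply: (iffP exists_inP) => [[T TE]|[e [f [eE fE]]]].
  rewrite subUset !sub1set => /andP[uT vT].
  have [e eE Te] := dual_private TE uT; have [f fE Tf] := dual_private TE vT.
  have/setP/(_ u) := Te; have/setP/(_ v) := Te.
  have/setP/(_ u) := Tf; have/setP/(_ v) := Tf.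
  rewrite !inE uT vT /= eqxx (negPf uv) (eq_sym v) (negPf uv) eqxx.
  move=> vf uf ve ue; exists e, f; rewrite ue ve vf uf; split=> // g gE.
  (* A vertex of [T] on such a [g] would lie on [e] or [f], hence be [u] or [v], which [g]
     avoids. *)
  move: TE; rewrite inE => /minsetP[/forall_inP/(_ g gE)/set0Pn[x xTg] _].
  move: xTg; rewrite inE => /andP[xT xg]; apply/negP => /subsetP/(_ x xg).
  rewrite !inE; have/setP/(_ x) := Te; have/setP/(_ x) := Tf.
  by rewrite !inE xT /= => -> ->; case: (x == u); case: (x == v).
move=> /andP[ue ve] /andP[vf uf] nog.
pose T0 := ~: ((e :|: f) :\: [set u; v]).
have trT0 : is_transversal_of E T0.
  by apply/forall_inP => g /nog; rewrite setIC setI_eq0 -subsets_disjoint.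
have [T minT sTT0] := minset_exists trT0.
exists T; first by rewrite inE.
(* A hyperedge inside [e :|: f] meets [T0] in [u] or [v] only; if it contains just one of them, [T]
   must contain that one. *)
have inT x h : h \in E -> h \subset e :|: f -> x \in h ->
    (forall y, y \in h -> (y == u) || (y == v) -> y = x) -> x \in T.
  move=> hE hef xh only; have /minsetP[/forall_inP/(_ h hE)/set0Pn[y yTh] _] := minT.
  move: yTh; rewrite inE => /andP[yT yh]; have := subsetP sTT0 y yT.
  have := subsetP hef y yh; rewrite !inE => -> /[!andbT] /[!negbK] uvy.
  by rewrite -(only y yh uvy).
rewrite subUset !sub1set; apply/andP; split.
  apply: (inT u e) => // [|y ye /orP[]/eqP yuv]; rewrite ?subsetUl // yuv //.
  by rewrite yuv in ye; rewrite ye in ve.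
apply: (inT v f) => // [|y yf /orP[]/eqP yuv]; rewrite ?subsetUr // yuv //.
by rewrite yuv in yf; rewrite yf in uf.
Qed.

Lemma conformal_dualP k : 0 < #|V| -> dimension E <= k ->
  reflect ((forall e (xs : seq V), e \in E -> size xs = k ->
              {in xs &, forall x y, near x y} ->
              exists2 v, v \in e & {in xs, forall x, near v x})
           /\ forall w, exists e, [/\ e \in E, w \in e
                & {in e, forall x, near w x -> x = w}])
          (conformal (dual_hypergraph E)).
Proof.
move=> V0 dimE; apply: (iffP forallP) => [cf|[hit priv] U].
  have clique_in U : {in U &, forall u v, near u v} ->
      exists2 T, T \in dual_hypergraph E & U \subset T.
    move=> clU; apply/exists_inP/(implyP (cf U)).
    apply/forall_inP => u uU; apply/forall_inP => v vU.
    by apply/implyP => uv; have := clU u v uU vU; rewrite /near (negPf uv).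
  split=> [e xs eE _ clxs|w].
    have [|T TE sxT] := clique_in [set:: xs].
      by move=> x y; rewrite !inE; apply: clxs.
    have := TE; rewrite inE => /minsetP[/forall_inP/(_ e eE)/set0Pn[v vTe] _].
    move: vTe; rewrite inE => /andP[vT ve]; exists v => // x xxs.
    rewrite /near; apply/orP; right; apply/exists_inP; exists T => //.
    by rewrite subUset !sub1set vT (subsetP sxT) // inE.
  pose X := [set x | (x != w) && near w x].
  have [trX|] := boolP (is_transversal_of E X); last first.
    rewrite /is_transversal_of negb_forall_in => /exists_inP[e eE].
    rewrite negbK => /eqP Xe.
    have out x : x \in e -> near w x -> x = w.
      move=> xe wx; apply/eqP/negPn/negP => xw.
      by move/setP/(_ x): Xe; rewrite !inE xw wx xe.
    exists e; split=> //.
    (* The missed hyperedge contains [w]: a minimal transversal through [w] meets it in a vertex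
       near [w], which can only be [w]. *)
    have [|T TE] := clique_in [set w].
      by move=> x y /set1P-> /set1P->; apply: near_refl.
    rewrite sub1set => wT; have := TE.
    rewrite inE => /minsetP[/forall_inP/(_ e eE)/set0Pn[x xTe] _].
    move: xTe; rewrite inE => /andP[xT xe]; rewrite -[X in X \in e](out x xe) //.
    apply/orP; right; apply/exists_inP; exists T => //.
    by rewrite subUset !sub1set wT.
  have [T minT sTX] := minset_exists trX.
  have TE : T \in dual_hypergraph E by rewrite inE.
  have nearT x y : x \in T -> y \in T -> near x y.
    move=> xT yT; apply/orP; right; apply/exists_inP; exists T => //.
    by rewrite subUset !sub1set xT.
  have nearw x : x \in T -> near w x.
    by move=> /(subsetP sTX); rewrite inE => /andP[].
  have [|T'] := clique_in (w |: T).
    move=> x y /setU1P[->|xT] /setU1P[->|yT]; last exact: nearT.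
    - exact: near_refl.
    - exact: nearw.
    - by rewrite near_sym nearw.
  (* The minimal transversal [T'] contains the transversal [T], hence equals it, although [w] is not
     in [X]. *)
  rewrite inE => /minsetP[_ minT']; rewrite subUset sub1set => /andP[wT' sTT'].
  have /minsetP[trT _] := minT; have TT' := minT' T trT sTT'.
  by have := subsetP sTX w; rewrite TT' !inE eqxx => /(_ wT').
apply/implyP => /forall_inP clU.
pose clq (A : {set V}) := [forall x in A, forall y in A, near x y].
have clqU : clq U.
  apply/forall_inP => x xU; apply/forall_inP => y yU; apply/orP.
  have [|xy] := eqVneq x y; first by left.
  by right; move/forall_inP: (clU x xU) => /(_ y yU); rewrite xy.
have [T /maxsetP[clT maxT] sUT] := maxset_exists clqU.
have nearT : {in T &, forall x y, near x y}.
  by move=> x y xT yT; move/forall_inP: clT => /(_ x xT)/forall_inP/(_ y yT).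
have far v : v \notin T -> exists2 u, u \in T & ~~ near v u.
  move=> vT; apply/exists_inP; rewrite -negb_forall_in; apply/negP => /forall_inP nv.
  move/negP: vT; apply; rewrite -(maxT (v |: T)) ?setU11 ?subsetUr //.
  apply/forall_inP => x /setU1P xvT; apply/forall_inP => y /setU1P yvT.
  case: xvT yvT => [->|xT] [->|yT]; last exact: nearT.
  - exact: near_refl.
  - exact: nv.
  - by rewrite near_sym nv.
apply/exists_inP; exists T => //; rewrite inE; apply/minsetP; split.
  apply/forall_inP => e eE; apply/negP => /eqP Te0.
  have [x0 _] : exists x0 : V, x0 \in V by apply/card_gt0P.
  have [a aT] : exists a, a \in T.
    by case: (boolP (x0 \in T)) => [|/far[a]]; [exists x0 | exists a].
  have notT v : v \in e -> v \notin T.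
    by move=> ve; apply/negP => vT; move/setP/(_ v): Te0; rewrite !inE ve vT.
  (* For [v] in [e] such a [u] exists by [far], so the default [a] is not taken there. *)
  pose f v := odflt a [pick u in T | ~~ near v u].
  have fT v : f v \in T by rewrite /f; case: pickP => //= u /andP[].
  have le_e : #|e| <= k.
    by apply: leq_trans dimE; apply: (leq_bigmax_cond (F := fun e => #|e|)).
  (* Condition (a) wants exactly [k] vertices; copies of [a] pad the list. *)
  have [||v ve nv] := hit e (map f (enum e) ++ nseq (k - #|e|) a) eE.
  - by rewrite size_cat size_map -cardE size_nseq subnKC.
  - have inT x : x \in map f (enum e) ++ nseq (k - #|e|) a -> x \in T.
      by rewrite mem_cat => /orP[/mapP[y _ ->]|/nseqP[->]].
    by move=> x y /inT xT /inT yT; apply: nearT.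
  have /negP := notT v ve; case; have : near v (f v).
    by apply: nv; rewrite mem_cat map_f ?mem_enum.
  rewrite /f; case: pickP => [u /andP[_ /negPf ->]//|none _].
  apply/negPn/negP => /far[u uT nvu].
  by have := none u; rewrite /= uT nvu.
move=> B /forall_inP trB sBT; apply/eqP; rewrite eqEsubset sBT /=.
apply/subsetP => w wT; have [e [eE we out]] := priv w.
have /set0Pn[x] := trB e eE; rewrite inE => /andP[xB xe].
by rewrite -(out x xe) // nearT // (subsetP sBT).
Qed.

End DualConformality.

(** * Total correctness with time bounds *)

Definition runs W p s t (Q : state -> Prop) : Prop :=
  exists t' s', [/\ exec W p s t' s', t' <= t & Q s'].

Section Runs.
Variable W : nat.
Implicit Types (p q : prog) (s : state) (t : nat) (Q : state -> Prop).

Lemma runs_weaken p s t t' Q Q' :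
  runs W p s t Q -> t <= t' -> (forall s', Q s' -> Q' s') -> runs W p s t' Q'.
Proof.
by move=> [u [s' [e le_u Qs]]] le_t QQ'; exists u, s'; split; auto; lia.
Qed.

Lemma runs_slack t p s t' Q : runs W p s t Q -> t <= t' -> runs W p s t' Q.
Proof. by move=> run le_t; apply: runs_weaken run le_t _. Qed.

Lemma runs_skip s Q : Q s -> runs W Skip s 1 Q.
Proof. by exists 1, s; split=> //; constructor. Qed.

Lemma runs_const x n s Q :
  n < W -> Q (set_reg s x n) -> runs W (Const x n) s 1 Q.
Proof. by exists 1, (set_reg s x n); split=> //; constructor. Qed.

Lemma runs_op o x y z s Q : eval_op o (reg s y) (reg s z) < W ->
  Q (set_reg s x (eval_op o (reg s y) (reg s z))) -> runs W (Op o x y z) s 1 Q.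
Proof.
move=> lt_W Qs; exists 1; eexists; split; [by constructor|by []|by []].
Qed.

Lemma runs_fetch x y s Q :
  Q (set_reg s x (ram s (reg s y))) -> runs W (Fetch x y) s 1 Q.
Proof. by exists 1; eexists; split; [constructor| |]. Qed.

Lemma runs_store x y s Q :
  Q (set_ram s (reg s x) (reg s y)) -> runs W (Store x y) s 1 Q.
Proof. by exists 1; eexists; split; [constructor| |]. Qed.

(** The postcondition of [p] is the run of [q], so that straight-line code is executed symbolically
    from front to back. *)
Lemma runs_seq p q s t u Q :
  runs W p s t (fun s' => runs W q s' u Q) -> runs W (Seq p q) s (t + u) Q.
Proof.
move=> [t' [s' [ep le_t [u' [s'' [eq le_u Qs]]]]]].
by exists (t' + u'), s''; split; [apply: exec_seq ep eq| lia|].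
Qed.

Lemma runs_if b p q s t Q :
  runs W (if eval_test b s then p else q) s t Q -> runs W (If b p q) s t.+1 Q.
Proof.
case: ifP => [hb|/negbT hb] [t' [s' [e le_t Qs]]]; exists t'.+1, s'; split=> //.
  exact: exec_if_true.
exact: exec_if_false.
Qed.

(* The body may skip positions, as when a loop exits early. *)
Lemma runs_while b p (I : nat -> state -> Prop) m (t : nat -> nat) j s :
  (forall i s', i < m -> I i s' -> eval_test b s') ->
  (forall i s', i < m -> I i s' ->
     runs W p s' (t i) (fun s'' => exists i', [/\ i < i', i' <= m & I i' s''])) ->
  (forall s', I m s' -> ~~ eval_test b s') ->
  j <= m -> I j s ->
  runs W (While b p) s (\sum_(j <= i < m) (t i).+1).+1 (I m).
Proof.
move=> tst body stop; have [d] := ubnP (m - j).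
elim: d j s => // d IHd j s lt_d le_j Ij.
have [lt_j|ge_j] := ltnP j m; last first.
  have eq_j : j = m by lia.
  move: Ij; rewrite eq_j => Im; exists 1, s; split=> //.
  exact: exec_while_false (stop _ Im).
have [t1 [s1 [e1 le_t1 [i [lt_ji le_im Ii]]]]] := body _ _ lt_j Ij.
have [|t2 [s2 [e2 le_t2 Qs]]] := IHd i s1 _ le_im Ii; first by lia.
exists (t1 + t2).+1, s2; split=> //.
  exact: exec_while_true (tst _ _ lt_j Ij) e1 e2.
(* The sum splits into position [j], the skipped positions, which are pure slack, and the rest. *)
rewrite big_ltn // (big_cat_nat lt_ji le_im) /=.
move: le_t2; set A := \sum_(i <= _ < m) _; set B := \sum_(_ <= _ < i) _.
by move: A B => A B; lia.
Qed.

(** The common shape of the compiled quantifiers: [body] leaves [P i] in register 0, and a success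
    makes [exit] jump to the final position [m] with register 0 still 1. *)
Lemma runs_search b body exit step (J : nat -> state -> Prop) m
    (P : nat -> bool) (t : nat -> nat) c s :
  (forall i s', i < m -> J i s' -> eval_test b s') ->
  (forall s', J m s' -> ~~ eval_test b s') ->
  (forall i s', J i s' -> reg s' 1 = 1) ->
  (forall i s', i < m -> J i s' ->
     runs W body s' (t i) (fun s'' => reg s'' 0 = P i /\ J i s'')) ->
  (forall i s', i < m -> J i s' ->
     runs W exit s' c (fun s'' => reg s'' 0 = reg s' 0 /\ J m s'')) ->
  (forall i s', i < m -> J i s' ->
     runs W step s' c (fun s'' => reg s'' 0 = reg s' 0 /\ J i.+1 s'')) ->
  J 0 s -> reg s 0 = 0 ->
  runs W (While b (Seq body (If (Eq 0 1) exit step))) s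
    (\sum_(0 <= i < m) (t i + c.+1).+1).+1
    (fun s' => reg s' 0 = has P (iota 0 m) /\ J m s').
Proof.
move=> tst stop one hbody hexit hstep J0 r0.
pose I i s' := [/\ reg s' 0 = has P (iota 0 i), i < m -> reg s' 0 = 0 & J i s'].
have := @runs_while b (Seq body (If (Eq 0 1) exit step)) I m
  (fun i => t i + c.+1) 0 s.
move=> H; apply: (runs_weaken (H _ _ _ _ _)) => //.
- by move=> i s' lt_i [_ _ /tst]; apply.
- move=> i s' lt_i [ri r0i Ji].
  have {}r0i := r0i lt_i; rewrite r0i in ri.
  have hasF : has P (iota 0 i) = false by case: has ri.
  apply: runs_seq; apply: (runs_weaken (hbody i s' lt_i Ji)) => // s1 [r1 J1].
  apply: runs_if => /=; rewrite (one _ _ J1) r1.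
  case Pi: (P i) => /=.
    apply: (runs_weaken (hexit i s1 lt_i J1)) => // s2 [r2 J2].
    exists m; split=> //; split=> //; last by rewrite ltnn.
    rewrite r2 r1 Pi; suff -> : has P (iota 0 m) by [].
    by apply/hasP; exists i; rewrite ?mem_iota.
  apply: (runs_weaken (hstep i s1 lt_i J1)) => // s2 [r2 J2].
  exists i.+1; split=> //; split=> //; last by rewrite r2 r1 Pi.
  by rewrite r2 r1 Pi -addn1 iotaD has_cat hasF /= add0n Pi.
- by move=> s' [_ _ /stop].
- by move=> s' [].
Qed.

End Runs.

Lemma upd_eq f i x : upd f i x i = x.
Proof. by rewrite /upd eqxx. Qed.

Lemma upd_neq f i x j : j != i -> upd f i x j = f j.
Proof. by rewrite /upd => /negPf ->. Qed.

(** * Bounded formulas and their compilation *)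

(* Bound variables are de Bruijn levels: the binder met at depth d binds the
   variable d.  A variable ranging over hyperedges holds the address of the
   encoding of its hyperedge. *)
Inductive form :=
  | FEq of nat & nat
  | FNear of nat & nat
  | FNot of form
  | FAnd of form & form
  | FExV of form
  | FExE of form
  | FExIn of nat & form.

Section Semantics.
Variable r : nat -> nat.

(** The word at the address of a hyperedge is its size, and its vertices follow. The first hyperedge
    is at address 2, after the words |V| and |E|. *)
Definition next_edge p := p + (r p).+1.
Definition edge_ptrs := traject next_edge 2 (r 1).
Definition input_end := iter (r 1) next_edge 2.
Definition entries p := [seq r i | i <- iota p.+1 (r p)].

Fixpoint eval d (env : nat -> nat) f : bool :=
  match f with
  | FEq x y => env x == env y
  | FNear x y => r (env x * r 0 + env y + input_end) == 1
  | FNot f => ~~ eval d env f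
  | FAnd f g => eval d env f && eval d env g
  | FExV f => has (fun v => eval d.+1 (upd env d v) f) (iota 0 (r 0))
  | FExE f => has (fun p => eval d.+1 (upd env d p) f) edge_ptrs
  | FExIn e f => has (fun v => eval d.+1 (upd env d v) f) (entries (env e))
  end.

(** A conjunction pays for its second part only if the first holds; the factor Delta^2 comes from
    this. Loops are charged in full despite early exits, and 6 and 5 cover the control of an
    iteration and of a loop. *)
Fixpoint cost d (env : nat -> nat) f : nat :=
  match f with
  | FEq x y => 2
  | FNear x y => 6
  | FNot f => cost d env f + 2
  | FAnd f g => cost d env f + (eval d env f * cost d env g + 2)
  | FExV f => \sum_(v <- iota 0 (r 0)) (cost d.+1 (upd env d v) f + 6) + 5
  | FExE f => \sum_(p <- edge_ptrs) (cost d.+1 (upd env d p) f + 6) + 5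
  | FExIn e f =>
      \sum_(v <- entries (env e)) (cost d.+1 (upd env d v) f + 6) + 5
  end.

End Semantics.

(* Register 0 holds the truth value computed last; registers 1, 2 and 3 hold 1,
   the number of vertices and the address following the input, where the table
   of nearness starts.  A variable owns three registers, the last two being the
   current address and the final address of a loop over a hyperedge. *)
Definition var i := 4 + 3 * i.

(** Multiplication by register 1 copies a register; a successful search copies the bound of the loop
    into its counter. The registers from [var d] on are free at depth [d]. *)
Fixpoint compile d f : prog :=
  match f with
  | FEq x y => If (Eq (var x) (var y)) (Const 0 1) (Const 0 0)
  | FNear x y =>
      Seq (Op Mul (var d) (var x) 2)
     (Seq (Op Add (var d) (var d) (var y))
     (Seq (Op Add (var d) (var d) 3)
     (Seq (Fetch 0 (var d))
          (If (Eq 0 1) (Const 0 1) (Const 0 0)))))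
  | FNot f => Seq (compile d f) (If (Eq 0 1) (Const 0 0) (Const 0 1))
  | FAnd f g => Seq (compile d f) (If (Eq 0 1) (compile d g) Skip)
  | FExV f =>
      Seq (Const 0 0) (Seq (Const (var d) 0)
     (While (Lt (var d) 2)
        (Seq (compile d.+1 f)
        (If (Eq 0 1) (Op Mul (var d) 2 1) (Op Add (var d) (var d) 1)))))
  | FExE f =>
      Seq (Const 0 0) (Seq (Const (var d) 2)
     (While (Lt (var d) 3)
        (Seq (compile d.+1 f)
        (If (Eq 0 1) (Op Mul (var d) 3 1)
           (Seq (Fetch (var d).+1 (var d))
           (Seq (Op Add (var d) (var d) (var d).+1)
                (Op Add (var d) (var d) 1)))))))
  | FExIn e f =>
      Seq (Const 0 0) (Seq (Op Add (var d).+1 (var e) 1)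
     (Seq (Fetch (var d).+2 (var e))
     (Seq (Op Add (var d).+2 (var d).+2 (var d).+1)
     (While (Lt (var d).+1 (var d).+2)
        (Seq (Seq (Fetch (var d) (var d).+1) (compile d.+1 f))
        (If (Eq 0 1) (Op Mul (var d).+1 (var d).+2 1)
           (Op Add (var d).+1 (var d).+1 1)))))))
  end.

(* [ts] tells for each bound variable whether it ranges over hyperedges. *)
Fixpoint typed (ts : seq bool) f : bool :=
  match f with
  | FEq x y | FNear x y => (x < size ts) && (y < size ts)
  | FNot f => typed ts f
  | FAnd f g => typed ts f && typed ts g
  | FExV f => typed (rcons ts false) f
  | FExE f => typed (rcons ts true) f
  | FExIn e f => nth false ts e && typed (rcons ts false) f
  end.

Ltac vlia := unfold var in *; lia.

(** * Correctness and running time of compiled formulas *)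

Section Compile.
Variables (N : nat) (r : nat -> nat).

Definition frame (s : state) : Prop :=
  [/\ reg s 1 = 1, reg s 2 = r 0, reg s 3 = input_end r & ram s = r].

Definition agree d (env : nat -> nat) (s : state) : Prop :=
  forall i, i < d -> reg s (var i) = env i /\ env i <= N.

(** Register 0 carries the result and registers from [var d] on are scratch, so both are exempt. *)
Definition keeps d (s s' : state) : Prop :=
  ram s' = ram s /\ forall i, 0 < i < var d -> reg s' i = reg s i.

Lemma keeps_trans d s1 s2 s3 : keeps d s1 s2 -> keeps d s2 s3 -> keeps d s1 s3.
Proof.
by move=> [m12 k12] [m23 k23]; split=> [|i i_d]; rewrite ?m23 // k23 ?k12.
Qed.

Lemma keepsW d s s' : keeps d.+1 s s' -> keeps d s s'.
Proof. by move=> [m k]; split=> // i i_d; apply: k; vlia. Qed.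

Lemma keeps_set d s s' i x :
  keeps d s s' -> (i == 0) || (var d <= i) -> keeps d s (set_reg s' i x).
Proof.
by move=> [m k] i_d; split=> // j j_d; rewrite /= upd_neq ?k //; vlia.
Qed.

Lemma keeps_frame d s s' : keeps d s s' -> frame s -> frame s'.
Proof.
by move=> [m k] [r1 r2 r3 rm]; split; rewrite ?m // k //; vlia.
Qed.

Lemma keeps_agree d env s s' : keeps d s s' -> agree d env s -> agree d env s'.
Proof.
move=> [_ k] ag i i_d; have [rE le_N] := ag i i_d; split=> //.
by rewrite k //; vlia.
Qed.

Lemma agree_bind d env s x : agree d env s -> reg s (var d) = x -> x <= N ->
  agree d.+1 (upd env d x) s.
Proof.
move=> ag rd x_N i; rewrite ltnS leq_eqVlt => /orP[/eqP ->|lt_id].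
  by rewrite upd_eq.
by rewrite upd_neq; [apply: ag | lia].
Qed.

Lemma next_iter_lt i j : i < j ->
  iter i (next_edge r) 2 < iter j (next_edge r) 2.
Proof.
elim: j => // j IHj; rewrite ltnS leq_eqVlt => /orP[/eqP ->|/IHj];
  by rewrite iterS /next_edge; lia.
Qed.

Lemma edge_ptrsE :
  edge_ptrs r = [seq iter i (next_edge r) 2 | i <- iota 0 (r 1)].
Proof.
rewrite /edge_ptrs; elim: (r 1) => // n IHn.
by rewrite trajectSr IHn -[n.+1]addn1 iotaD map_cat cats1.
Qed.

Section Bounds.
Variable W : nat.
Hypotheses (r_le : forall i, r i <= N) (end_le : input_end r <= N).
Hypothesis ltW : N * N + 3 * N + 3 < W.

(** Each quantifier is an instance of [runs_search]. The largest words are addresses in the table,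
    at most [N * N + 2 * N], and loop bounds, at most [2 * N + 1]. *)
Lemma compile_runs f ts env s :
  typed ts f -> frame s -> agree (size ts) env s ->
  runs W (compile (size ts) f) s (cost r (size ts) env f)
    (fun s' => reg s' 0 = eval r (size ts) env f /\ keeps (size ts) s s').
Proof.
have keeps_refl d s' : keeps d s' s' by split.
elim: f ts env s => [x y|x y|f IHf|f IHf g IHg|f IHf|f IHf|e f IHf] ts env s
  /=; set d := size ts.
- move=> /andP[x_d y_d] fr ag; apply: runs_if => /=.
  have [-> _] := ag x x_d; have [-> _] := ag y y_d.
  by case: eqP => _;
    (apply: runs_const; [lia|split; [by rewrite /= upd_eq|exact: keeps_set]]).
- move=> /andP[x_d y_d] [r1 r2 r3 rm] ag.
  have [rx x_N] := ag x x_d; have [ry y_N] := ag y y_d.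
  have := r_le 0 => r0_N.
  have bnd : env x * r 0 <= N * N by apply: leq_mul.
  have y_ne : var y != var d by vlia.
  rewrite -[6]/(1 + (1 + (1 + (1 + 2)))).
  apply: runs_seq; apply: runs_op; rewrite /= ?rx ?r2; first lia.
  apply: runs_seq; apply: runs_op; rewrite /= upd_eq upd_neq // ry; first lia.
  apply: runs_seq; apply: runs_op; rewrite /= upd_eq !upd_neq // ?r3; first lia.
  apply: runs_seq; apply: runs_fetch; rewrite /= upd_eq rm.
  have k3 : keeps d s (set_reg (set_reg (set_reg (set_reg s (var d) (env x * r 0))
     (var d) (env x * r 0 + env y)) (var d) (env x * r 0 + env y + input_end r))
     0 (r (env x * r 0 + env y + input_end r))).
    by do !apply: keeps_set => //=; rewrite leqnn orbT.
  apply: runs_if; rewrite /= upd_eq !upd_neq // r1.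
  by case: eqP => _;
    (apply: runs_const; [lia|split; [by rewrite /= upd_eq|exact: keeps_set]]).
- move=> tf fr ag; apply: runs_seq; apply: runs_weaken (IHf _ _ _ tf fr ag) _ _ => //.
  move=> s' [rf k]; apply: runs_if; have [r1 _ _ _] := keeps_frame k fr.
  rewrite /= r1 rf eqb1.
  by case: (eval _ _ _ _);
    (apply: runs_const; [lia|split; [by rewrite /= upd_eq|exact: keeps_set]]).
- move=> /andP[tf tg] fr ag; apply: runs_seq.
  apply: runs_weaken (IHf _ _ _ tf fr ag) _ _ => //.
  move=> s' [rf k]; rewrite addn2; apply: runs_if.
  have [r1 _ _ _] := keeps_frame k fr; rewrite /= r1 rf eqb1.
  case: (eval r d env f) rf => /= rf; last by rewrite mul0n; apply: runs_skip.
  rewrite mul1n; apply: runs_weaken (IHg _ _ _ tg _ _) _ _ => //.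
  + exact: keeps_frame k fr.
  + exact: keeps_agree k ag.
  by move=> s'' [rg k']; split=> //; apply: keeps_trans k k'.
- move=> tf fr ag; pose J i s' := keeps d s s' /\ reg s' (var d) = i.
  pose t i := cost r d.+1 (upd env d i) f.
  have J_fr i s' : J i s' -> frame s' by case=> k _; apply: keeps_frame k fr.
  apply: (@runs_weaken _ _ _ (1 + (1 + (\sum_(0 <= i < r 0) (t i + 4).+1).+1))).
  + apply: runs_seq; apply: runs_const; first lia.
    apply: runs_seq; apply: runs_const; first lia.
    apply: (@runs_search _ _ _ _ _ J (r 0)
             (fun i => eval r d.+1 (upd env d i) f) t 3).
    * by move=> i s' i_m [k rd]; have [_ /= -> _ _] := keeps_frame k fr; rewrite rd.
    * by move=> s' [k rd]; have [_ /= -> _ _] := keeps_frame k fr; rewrite rd ltnn.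
    * by move=> i s' /J_fr[].
    * move=> i s' i_m [k rd]; have := IHf (rcons ts false) (upd env d i) s'.
      rewrite size_rcons -/d => /(_ tf (keeps_frame k fr)) IH.
      have {}IH := IH (agree_bind (keeps_agree k ag) rd _).
      apply: runs_weaken (IH _) _ _; rewrite //.
        by have := r_le 0; lia.
      move=> s2 [-> k2]; split=> //; split; first exact: keeps_trans k (keepsW k2).
      by have [_ ->] := k2; rewrite // /var; lia.
    * move=> i s' i_m [k rd]; have [r1 r2 _ _] := keeps_frame k fr.
      have := r_le 0 => r0_N.
      apply: (@runs_slack _ 1) => //; apply: runs_op.
        by rewrite /= r1 r2; lia.
      split; first by rewrite /= upd_neq.
      split; first by apply: keeps_set => //; rewrite leqnn orbT.
      by rewrite /= upd_eq r1 r2 muln1.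
    * move=> i s' i_m [k rd]; have [r1 r2 _ _] := keeps_frame k fr.
      have := r_le 0 => r0_N.
      apply: (@runs_slack _ 1) => //; apply: runs_op.
        by rewrite /= r1 rd; lia.
      split; first by rewrite /= upd_neq.
      split; first by apply: keeps_set => //; rewrite leqnn orbT.
      by rewrite /= upd_eq r1 rd addn1.
    * split; last by rewrite /= upd_eq.
      by do !apply: keeps_set => //=; rewrite leqnn orbT.
    * by rewrite /= upd_neq // upd_eq.
  + have : \sum_(0 <= i < r 0) (t i + 4).+1 <=
      \sum_(i <- iota 0 (r 0)) (cost r d.+1 (upd env d i) f + 6).
      by rewrite /index_iota subn0; apply: leq_sum => i _; rewrite /t; lia.
    by rewrite -(leq_add2r 5); apply: leq_trans; lia.
  + by move=> s' [rf [k _]].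
- move=> tf fr ag; pose p i := iter i (next_edge r) 2.
  pose J i s' := keeps d s s' /\ reg s' (var d) = p i.
  pose t i := cost r d.+1 (upd env d (p i)) f.
  have J_fr i s' : J i s' -> frame s' by case=> k _; apply: keeps_frame k fr.
  have p_lt i : i < r 1 -> p i < input_end r by exact: next_iter_lt.
  (* Equality occurs at the last hyperedge, which ends where the input ends. *)
  have pS_le i : i < r 1 -> p i + (r (p i)).+1 <= input_end r.
    rewrite -[p i + _]/(p i.+1) leq_eqVlt => /orP[/eqP i1|/p_lt/ltnW //].
    by rewrite /p i1.
  have N_W : N < W by lia.
  rewrite edge_ptrsE has_map big_map.
  apply: (@runs_weaken _ _ _ (1 + (1 + (\sum_(0 <= i < r 1) (t i + 4).+1).+1))).
  + apply: runs_seq; apply: runs_const; first lia.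
    apply: runs_seq; apply: runs_const; first lia.
    apply: (@runs_search _ _ _ _ _ J (r 1)
             (fun i => eval r d.+1 (upd env d (p i)) f) t 3).
    * move=> i s' i_m [k rd]; have [_ _ /= -> _] := keeps_frame k fr.
      by rewrite rd p_lt.
    * move=> s' [k rd]; have [_ _ /= -> _] := keeps_frame k fr.
      by rewrite rd ltnn.
    * by move=> i s' /J_fr[].
    * move=> i s' i_m [k rd]; have := IHf (rcons ts true) (upd env d (p i)) s'.
      rewrite size_rcons -/d => /(_ tf (keeps_frame k fr)) IH.
      have {}IH := IH (agree_bind (keeps_agree k ag) rd _).
      apply: runs_weaken (IH _) _ _; rewrite //.
        by have := p_lt i i_m; lia.
      move=> s2 [-> k2]; split=> //; split; first exact: keeps_trans k (keepsW k2).
      by have [_ ->] := k2; rewrite // /var; lia.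
    * move=> i s' i_m [k rd]; have [r1 _ r3 _] := keeps_frame k fr.
      apply: (@runs_slack _ 1) => //; apply: runs_op.
        by rewrite /= r1 r3; lia.
      split; first by rewrite /= upd_neq.
      split; first by apply: keeps_set => //; rewrite leqnn orbT.
      by rewrite /= upd_eq r1 r3 muln1.
    * move=> i s' i_m [k rd]; have [r1 _ _ rm] := keeps_frame k fr.
      have := pS_le i i_m => pS.
      rewrite -[3]/(1 + (1 + 1)); apply: runs_seq; apply: runs_fetch.
      have ne : var d != (var d).+1 by lia.
      apply: runs_seq; apply: runs_op; rewrite /= upd_eq upd_neq // rd rm.
        by lia.
      apply: runs_op; rewrite /= upd_eq !upd_neq ?r1 //; first lia.
      split; first by [].
      split; first by do !apply: keeps_set => //=; rewrite ?leqnn ?leqnSn orbT.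
      by rewrite /= upd_eq -addnA addn1.
    * split; last by rewrite /= upd_eq.
      by do !apply: keeps_set => //=; rewrite leqnn orbT.
    * by rewrite /= upd_neq // upd_eq.
  + have : \sum_(0 <= i < r 1) (t i + 4).+1 <=
      \sum_(i <- iota 0 (r 1)) (cost r d.+1 (upd env d (p i)) f + 6).
      by rewrite /index_iota subn0; apply: leq_sum => i _; rewrite /t; lia.
    by rewrite -(leq_add2r 5); apply: leq_trans; lia.
  + by move=> s' [rf [k _]].
- move=> /andP[e_ts tf] fr ag.
  have e_d : e < d.
    rewrite ltnNge; apply/negP => /(nth_default false) e_ge.
    by rewrite e_ge in e_ts.
  have [re e_N] := ag e e_d; pose p := env e; pose m := r p.
  pose J i s' := [/\ keeps d s s', reg s' (var d).+1 = p.+1 + i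
                   & reg s' (var d).+2 = p.+1 + m].
  pose v i := r (p.+1 + i).
  (* The extra step fetches the vertex at the current address. *)
  pose t i := (cost r d.+1 (upd env d (v i)) f).+1.
  have J_fr i s' : J i s' -> frame s' by case=> k _ _; apply: keeps_frame k fr.
  have m_N : m <= N by exact: r_le.
  have -> : entries r (env e) = map v (iota 0 m).
    by rewrite /entries -[(env e).+1]addn0 iotaDl -map_comp.
  rewrite has_map big_map.
  apply: (@runs_weaken _ _ _
    (1 + (1 + (1 + (1 + (\sum_(0 <= i < m) (t i + 2).+1).+1))))).
  + apply: runs_seq; apply: runs_const; first lia.
    have [r1 _ _ rm] := fr.
    apply: runs_seq; apply: runs_op; rewrite /= !upd_neq ?re ?r1 //; first lia.
    have ne1 : var e != (var d).+1 by vlia.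
    apply: runs_seq; apply: runs_fetch; rewrite /= upd_neq // upd_neq // re rm.
    have ne2 : (var d).+1 != (var d).+2 by vlia.
    apply: runs_seq; apply: runs_op; rewrite /= upd_eq upd_neq // upd_eq.
      by rewrite -/p -/m; lia.
    apply: (@runs_search _ _ _ _ _ J m
             (fun i => eval r d.+1 (upd env d (v i)) f) t 1).
    * by move=> i s' i_m [k ra rl]; rewrite /= ra rl ltn_add2l.
    * by move=> s' [k ra rl]; rewrite /= ra rl ltnn.
    * by move=> i s' /J_fr[].
    * move=> i s' i_m [k ra rl]; have [r1' _ _ rm'] := keeps_frame k fr.
      apply: (@runs_slack _ (1 + (cost r d.+1 (upd env d (v i)) f))) => //.
      apply: runs_seq; apply: runs_fetch; rewrite ra rm' -/(v i).
      set s1 := set_reg _ _ _.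
      have k1 : keeps d s s1 by apply: keeps_set => //; rewrite leqnn orbT.
      have rd : reg s1 (var d) = v i by rewrite /= upd_eq.
      have := IHf (rcons ts false) (upd env d (v i)) s1.
      rewrite size_rcons -/d => /(_ tf (keeps_frame k1 fr)) IH.
      have {}IH := IH (agree_bind (keeps_agree k1 ag) rd _).
      apply: runs_weaken (IH (r_le _)) _ _ => //.
      move=> s2 [-> k2]; split=> //.
      split; first exact: keeps_trans k1 (keepsW k2).
        by have [_ ->] := k2; [rewrite /= upd_neq //; vlia | vlia].
      by have [_ ->] := k2; [rewrite /= upd_neq //; vlia | vlia].
    * move=> i s' i_m [k ra rl]; have [r1' _ _ rm'] := keeps_frame k fr.
      apply: runs_op; rewrite /= r1' rl; first lia.
      split; first by rewrite upd_neq.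
      split; first by apply: keeps_set => //; rewrite leqnSn orbT.
        by rewrite /= upd_eq muln1.
      by rewrite /= upd_neq //; lia.
    * move=> i s' i_m [k ra rl]; have [r1' _ _ rm'] := keeps_frame k fr.
      apply: runs_op; rewrite /= r1' ra; first lia.
      split; first by rewrite upd_neq.
      split; first by apply: keeps_set => //; rewrite leqnSn orbT.
        by rewrite /= upd_eq; lia.
      by rewrite /= upd_neq //; lia.
    * split.
      - by do !apply: keeps_set => //=; vlia.
      - by rewrite /= !(upd_neq _ _ ne2) upd_eq addn0 addn1.
      - by rewrite /= upd_eq -/p -/m; lia.
    * by [].
  + have : \sum_(0 <= i < m) (t i + 2).+1 <=
      \sum_(i <- iota 0 m) (cost r d.+1 (upd env d (v i)) f + 6).
      by rewrite /index_iota subn0; apply: leq_sum => i _; rewrite /t; lia.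
    by rewrite -(leq_add2r 5); apply: leq_trans; lia.
  + by move=> s' [rf [k _]].
Qed.

End Bounds.
End Compile.

(** * Meaning and cost of the formulas *)

Lemma eval_ext r f ts env env' :
  typed ts f -> (forall i, i < size ts -> env i = env' i) ->
  eval r (size ts) env f = eval r (size ts) env' f.
Proof.
have upd_ext (d : nat) (e e' : nat -> nat) x : (forall i, i < d -> e i = e' i) ->
    forall i, i < d.+1 -> upd e d x i = upd e' d x i.
  move=> ee' i; rewrite ltnS leq_eqVlt => /orP[/eqP ->|i_d].
    by rewrite !upd_eq.
  by rewrite !upd_neq ?ee' //; lia.
elim: f ts env env' => [x y|x y|f IHf|f IHf g IHg|f IHf|f IHf|e f IHf] ts env
  env' /=.
- by move=> /andP[/[swap]] + + ee' => /ee'-> /ee'->.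
- by move=> /andP[/[swap]] + + ee' => /ee'-> /ee'->.
- by move=> tf ee'; rewrite (IHf _ _ _ tf ee').
- by move=> /andP[tf tg] ee'; rewrite (IHf _ _ _ tf ee') (IHg _ _ _ tg ee').
- move=> tf ee'; apply: eq_has => v; have := IHf _ (upd env (size ts) v) _ tf.
  by rewrite size_rcons; apply; apply: upd_ext.
- move=> tf ee'; apply: eq_has => v; have := IHf _ (upd env (size ts) v) _ tf.
  by rewrite size_rcons; apply; apply: upd_ext.
- move=> /andP[e_ts tf] ee'.
  have e_d : e < size ts.
    rewrite ltnNge; apply/negP => /(nth_default false) e_ge.
    by rewrite e_ge in e_ts.
  rewrite ee' //; apply: eq_has => v; have := IHf _ (upd env (size ts) v) _ tf.
  by rewrite size_rcons; apply; apply: upd_ext.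
Qed.

(** A cruder count, independent of the environment: conjunctions pay for both parts. It loses the
    degrees, so for nearness it serves only below the loops over [e] and [f]. *)
Fixpoint cost_bound n m k f : nat :=
  match f with
  | FEq _ _ => 2
  | FNear _ _ => 6
  | FNot f => cost_bound n m k f + 2
  | FAnd f g => cost_bound n m k f + (cost_bound n m k g + 2)
  | FExV f => n * (cost_bound n m k f + 6) + 5
  | FExE f => m * (cost_bound n m k f + 6) + 5
  | FExIn _ f => k * (cost_bound n m k f + 6) + 5
  end.

Definition edges_le r k ts (env : nat -> nat) : Prop :=
  forall i, nth false ts i -> r (env i) <= k.

Lemma edges_le_bind r k ts env (b : bool) x :
  edges_le r k ts env -> (b -> r x <= k) ->
  edges_le r k (rcons ts b) (upd env (size ts) x).
Proof.
move=> le_ts le_x i; rewrite nth_rcons.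
case: ltngtP => [i_d /le_ts|//|->]; first by rewrite upd_neq //; lia.
by rewrite upd_eq.
Qed.

Lemma leq_sum_const (I : eqType) (s : seq I) (F : I -> nat) c :
  (forall i, i \in s -> F i <= c) -> \sum_(i <- s) F i <= size s * c.
Proof.
move=> le_c; rewrite big_seq -sum1_size big_distrl /= [leqRHS]big_seq.
by apply: leq_sum => i /le_c; rewrite mul1n.
Qed.

Lemma cost_le r k f ts env : typed ts f -> edges_le r k ts env ->
  (forall p, p \in edge_ptrs r -> r p <= k) ->
  cost r (size ts) env f <= cost_bound (r 0) (r 1) k f.
Proof.
move=> + + le_k.
elim: f ts env => [x y|x y|f IHf|f IHf g IHg|f IHf|f IHf|e f IHf] ts env //=.
- by move=> tf le_ts; rewrite leq_add2r IHf.
- move=> /andP[tf tg] le_ts; apply: leq_add; first exact: IHf.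
  rewrite leq_add2r; case: eval; rewrite ?mul1n ?mul0n //; exact: IHg.
- move=> tf le_ts; rewrite leq_add2r -[r 0 in leqRHS](size_iota 0).
  apply: leq_sum_const => v _; rewrite leq_add2r size_iota -(size_rcons ts false).
  by apply: (IHf _ _ tf); apply: edges_le_bind.
- move=> tf le_ts; rewrite leq_add2r.
  have -> : r 1 = size (edge_ptrs r) by rewrite size_traject.
  apply: leq_sum_const => p pE; rewrite leq_add2r size_traject -(size_rcons ts true).
  by apply: (IHf _ _ tf); apply: edges_le_bind => // _; apply: le_k.
- move=> /andP[e_ts tf] le_ts; rewrite leq_add2r.
  apply: (@leq_trans
    (size (entries r (env e)) * (cost_bound (r 0) (r 1) k f + 6))).
    apply: leq_sum_const => v _; rewrite leq_add2r -(size_rcons ts false).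
    by apply: (IHf _ _ tf); apply: edges_le_bind.
  by rewrite leq_mul2r size_map size_iota le_ts // orbT.
Qed.

Definition FOr f g := FNot (FAnd (FNot f) (FNot g)).
(** The argument [d] is the depth at which the formula is used, hence the level of the variable it
    binds. *)
Definition FIn d x e := FExIn e (FEq x d).
(** [FEq 0 0] stands for truth; it is typed as soon as one variable is bound. *)
Definition FNears (ps : seq (nat * nat)) :=
  foldr (fun p => FAnd (FNear p.1 p.2)) (FEq 0 0) ps.

Lemma eval_FNot r d env f : eval r d env (FNot f) = ~~ eval r d env f.
Proof. by []. Qed.

Lemma eval_FAnd r d env f g :
  eval r d env (FAnd f g) = eval r d env f && eval r d env g.
Proof. by []. Qed.

Lemma eval_FExE r d env f : eval r d env (FExE f) =
  has (fun p => eval r d.+1 (upd env d p) f) (edge_ptrs r).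
Proof. by []. Qed.

Lemma eval_FExIn r d env e f : eval r d env (FExIn e f) =
  has (fun v => eval r d.+1 (upd env d v) f) (entries r (env e)).
Proof. by []. Qed.

Lemma cost_FAnd r d env f g : cost r d env (FAnd f g) =
  cost r d env f + (eval r d env f * cost r d env g + 2).
Proof. by []. Qed.

Lemma cost_FNot r d env f : cost r d env (FNot f) = cost r d env f + 2.
Proof. by []. Qed.

Lemma cost_FExE r d env f : cost r d env (FExE f) =
  \sum_(p <- edge_ptrs r) (cost r d.+1 (upd env d p) f + 6) + 5.
Proof. by []. Qed.

Lemma eval_FOr r d env f g :
  eval r d env (FOr f g) = eval r d env f || eval r d env g.
Proof. by rewrite /FOr /= negb_and !negbK. Qed.

Lemma eval_FNears r d env ps : eval r d env (FNears ps) =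
  all (fun p => eval r d env (FNear p.1 p.2)) ps.
Proof. by elim: ps => [|p ps IH] /=; rewrite ?eqxx ?IH. Qed.

Lemma typed_FNears ts ps : 0 < size ts ->
  {in ps, forall p, (p.1 < size ts) && (p.2 < size ts)} -> typed ts (FNears ps).
Proof.
move=> ts0; elim: ps => [|p ps IH] /= ts_ps; first by rewrite ts0.
by rewrite ts_ps ?mem_head //= IH // => q qps; rewrite ts_ps // inE qps orbT.
Qed.

Lemma typed_iter_FExV k ts f :
  typed ts (iter k FExV f) = typed (ts ++ nseq k false) f.
Proof.
by elim: k ts => [|k IHk] ts /=; rewrite ?cats0 // IHk -cat_rcons.
Qed.

Lemma eval_iter_FExV r k f ts env : typed (ts ++ nseq k false) f ->
  reflect (exists env', [/\ forall i, i < size ts -> env' i = env i,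
             forall i, size ts <= i < size ts + k -> env' i < r 0
           & eval r (size ts + k) env' f])
          (eval r (size ts) env (iter k FExV f)).
Proof.
elim: k ts env => [|k IHk] ts env /=.
  rewrite cats0 addn0 => tf; apply: (iffP idP) => [ef|[env' [ee' _ ef]]].
    by exists env; split=> // i; lia.
  by rewrite -(eval_ext r tf ee').
rewrite -cat_rcons => tf; have := IHk _ _ tf; rewrite size_rcons addSnnS => IH.
apply: (iffP hasP) => [[x]|[env' [ee' lt' ef]]].
  rewrite mem_iota add0n => x_n /IH[env' [ee' lt' ef]].
  exists env'; split=> // i i_d.
    by rewrite ee' 1?ltnW // upd_neq //; lia.
  have [->|ne] := eqVneq i (size ts); first by rewrite ee' // upd_eq.
  by apply: lt'; lia.
exists (env' (size ts)); first by rewrite mem_iota add0n lt' //; lia.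
apply/IH; exists env'; split=> // i.
  rewrite ltnS leq_eqVlt => /orP[/eqP ->|i_d]; first by rewrite upd_eq.
  by rewrite upd_neq ?ee' //; lia.
by move=> i_d; apply: lt'; lia.
Qed.

(** One more loop turns a bound B into [n * (B + 6) + 5], at most [n * (B + 11)]. *)
Lemma cost_bound_iter_FExV n m k f j : 0 < n ->
  cost_bound n m k (iter j FExV f) <= (cost_bound n m k f + j * 11) * n ^ j.
Proof.
move=> n0; elim: j => [|j IHj] /=; first by rewrite mul0n addn0 muln1.
rewrite expnSr; have := expn_gt0 n j; rewrite n0 /=.
move: IHj; set B := cost_bound _ _ _ _; set C := cost_bound _ _ _ f.
move: (n ^ j) => P IHj P0.
have : n * B <= n * ((C + j * 11) * P) by rewrite leq_mul2l IHj orbT.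
have : n <= n * P by apply: leq_pmulr.
nia.
Qed.

(** Passes from addresses to hyperedges, two lists that match only through their decoded entries. *)
Lemma has_map_eq (A B : eqType) (X : eqType) (f : A -> X) (g : B -> X) s1 s2 P Q :
  map f s1 = map g s2 ->
  (forall a b, a \in s1 -> b \in s2 -> f a = g b -> P a = Q b) ->
  has P s1 = has Q s2.
Proof.
elim: s1 s2 => [|a s1 IH] [|b s2] //= [fg fgs] PQ.
rewrite (PQ a b) ?mem_head //; congr orb; apply: IH => // a' b' a1 b2.
by apply: PQ; rewrite inE ?a1 ?b2 orbT.
Qed.

Lemma leq_sum_map_eq (A B : eqType) (X : eqType) (f : A -> X) (g : B -> X)
    s1 s2 (P : A -> nat) (Q : B -> nat) :
  map f s1 = map g s2 ->
  (forall a b, a \in s1 -> b \in s2 -> f a = g b -> P a <= Q b) ->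
  \sum_(a <- s1) P a <= \sum_(b <- s2) Q b.
Proof.
elim: s1 s2 => [|a s1 IH] [|b s2] //=; first by rewrite !big_nil.
move=> [fg fgs] PQ; rewrite !big_cons.
apply: leq_add; first by apply: PQ; rewrite ?mem_head.
by apply: IH => // a' b' a1 b2; apply: PQ; rewrite inE ?a1 ?b2 orbT.
Qed.

(** * Formulas for nearness and for conditions (a) and (b) *)

Definition outside_form : form :=
  FOr (FEq 5 0) (FOr (FEq 5 1) (FAnd (FNot (FIn 6 5 2)) (FNot (FIn 6 5 3)))).

(** Levels 0 to 5 hold u, v, e, f, g and a vertex x of g; [outside_form] lets x witness that g is
    not contained in e :|: f minus u and v. Membership of u in e and of v in f is tested first, so
    that other hyperedges are dismissed cheaply. *)
Definition near_form : form :=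
  FOr (FEq 0 1)
  (FExE (FAnd (FIn 3 0 2) (FAnd (FNot (FIn 3 1 2))
  (FExE (FAnd (FIn 4 1 3) (FAnd (FNot (FIn 4 0 3))
  (FNot (FExE (FNot (FExIn 4 outside_form)))))))))).

(** Condition (a): level 0 holds e, levels 1 to [k] the x_i, and level [k.+1] the vertex of e. *)
Definition hit_form k : form :=
  let clique := FNears [seq (i, j) | i <- iota 1 k, j <- iota 1 k] in
  let dominated := FNears [seq (k.+1, i) | i <- iota 1 k] in
  FNot (FExE (iter k FExV (FAnd clique (FNot (FExIn 0 dominated))))).

(** Condition (b), with w, its hyperedge and another vertex of it at levels 0, 1 and 2. *)
Definition private_form : form :=
  FNot (FExV (FNot (FExE (FAnd (FIn 2 0 1)
    (FNot (FExIn 1 (FAnd (FNot (FEq 2 0)) (FNear 0 2)))))))).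

Lemma typed_hit_form k : typed [::] (hit_form k).
Proof.
rewrite /= typed_iter_FExV /=; apply/andP; split; apply: typed_FNears => //.
  move=> _ /allpairsP[[i j] /= [i_k j_k ->]].
  by move: i_k j_k; rewrite /= !mem_iota size_nseq; lia.
by move=> _ /mapP[i + ->]; rewrite /= mem_iota size_rcons size_nseq; lia.
Qed.

(** * Reading the encoded hypergraph; memory beyond the input is left free for the table *)

Section Input.
Variables (V : finType) (num : V -> 'I_#|V|) (E : {set {set V}}).
Variables (es : seq (seq V)) (r : nat -> nat).
Hypotheses (num_inj : injective num) (esE : edge_list E es).
Hypothesis r_input :
  forall i, i < size (encode num es) -> r i = nth 0 (encode num es) i.

Let code v : nat := num v.

Lemma code_inj : injective code.
Proof. by move=> u v /val_inj/num_inj. Qed.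

Lemma code_onto i : i < #|V| -> exists v, code v = i.
Proof.
move=> i_n; have : Ordinal i_n \in codom num by apply: inj_card_onto; rewrite ?card_ord.
by case/codomP => v vE; exists v; rewrite /code -vE.
Qed.

Lemma input0 : r 0 = #|V|. Proof. exact: r_input. Qed.

Lemma input1 : r 1 = size es. Proof. exact: r_input. Qed.

(** The starting address is arbitrary for the induction on the list of hyperedges. *)
Lemma parse l p :
  let b := flatten [seq size s :: [seq val (num v) | v <- s] | s <- l] in
  (forall i, i < size b -> r (p + i) = nth 0 b i) ->
  iter (size l) (next_edge r) p = p + size b /\
  [seq entries r q | q <- traject (next_edge r) p (size l)] = map (map code) l.
Proof.
elim: l p => [|s l IHl] p /=; first by rewrite addn0.
set b := flatten _ => rb; have rp : r p = size s by rewrite -[p]addn0 rb.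
have nextE : next_edge r p = p + (size s).+1 by rewrite /next_edge rp.
have [|iterE entE] := IHl (p + (size s).+1).
  move=> i i_b; have {}i_b : i < size b by []; rewrite -addnA rb; last first.
    by rewrite size_cat size_map -/b; lia.
  by rewrite addSn /= nth_cat size_map ltnNge leq_addr /= addKn.
split; first by rewrite -iterS iterSr nextE iterE -addnA size_cat size_map addSn.
rewrite nextE entE; congr cons; rewrite /entries rp.
apply: (@eq_from_nth _ 0) => [|i]; rewrite !size_map size_iota // => i_s.
rewrite (nth_map 0) ?size_iota // nth_iota // addSnnS rb; last first.
  by rewrite size_cat size_map; lia.
by rewrite /= nth_cat size_map i_s.
Qed.

Lemma input_endE : input_end r = size (encode num es).
Proof.
have [|e _] := @parse es 2; last by rewrite /input_end input1 e.
by move=> i i_b; rewrite r_input.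
Qed.

Lemma input_edges : [seq entries r p | p <- edge_ptrs r] = map (map code) es.
Proof.
have [|_] := @parse es 2; last by rewrite /edge_ptrs input1.
by move=> i i_b; rewrite r_input.
Qed.

Lemma has_edges P Q :
  (forall p s, p \in edge_ptrs r -> s \in es -> entries r p = map code s ->
     P p = Q s) ->
  has P (edge_ptrs r) = has Q es.
Proof. exact: has_map_eq input_edges. Qed.

Lemma has_vertices P : has P (iota 0 (r 0)) = [exists v, P (code v)].
Proof.
rewrite input0; apply/hasP/existsP => [[i]|[v Pv]].
  by rewrite mem_iota => /code_onto[v <-]; exists v.
by exists (code v); rewrite // mem_iota ltn_ord.
Qed.

Lemma exists_edge (P : pred {set V}) :
  [exists e in E, P e] = has (fun s => P [set:: s]) es.
Proof.
case: esE => _ _ EE; apply/exists_inP/hasP => [[e]|[s s_es Ps]].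
  by rewrite EE => /mapP[s s_es ->]; exists s.
by exists [set:: s] => //; rewrite EE map_f.
Qed.

Lemma eval_FIn d env x e u s : x < d -> e < d -> env x = code u ->
  entries r (env e) = map code s ->
  eval r d env (FIn d x e) = (u \in [set:: s]).
Proof.
move=> x_d e_d xu es'; rewrite /FIn /= es' has_map in_set -has_pred1.
apply: eq_has => v /=.
by rewrite upd_eq upd_neq ?xu ?(inj_eq code_inj) 1?eq_sym //; lia.
Qed.

Lemma eval_near_form env u v : env 0 = code u -> env 1 = code v ->
  eval r 2 env near_form = near E u v.
Proof.
move=> env0 env1; rewrite /near_form eval_FOr.
have [uv|uv] := eqVneq u v; first by rewrite /near /= env0 env1 uv !eqxx.
rewrite /near (negPf uv) [eval r 2 env (FEq 0 1)]/= env0 env1.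
rewrite (inj_eq code_inj) (negPf uv) !orFb.
(* The criterion is nested exactly as the quantifiers of [near_form], which are then matched one by
   one. *)
have -> : cooccur E u v = [exists e in E, [&& u \in e, v \notin e &
   [exists f in E, [&& v \in f, u \notin f &
   ~~ [exists g in E, g \subset (e :|: f) :\: [set u; v]]]]]].
  apply/(cooccurP E uv)/exists_inP.
    move=> [e [f [eE fE /andP[ue ve] /andP[vf uf] nog]]]; exists e => //.
    rewrite ue ve; apply/exists_inP; exists f => //; rewrite vf uf.
    by rewrite negb_exists_in; apply/forall_inP.
  move=> [e eE /and3P[ue ve /exists_inP[f fE /and3P[vf uf]]]].
  by rewrite negb_exists_in => /forall_inP nog; exists e, f; rewrite ue ve vf uf.
rewrite exists_edge eval_FExE; apply: has_edges => p s _ _ ps.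
rewrite eval_FAnd (@eval_FIn _ _ _ _ u s) //; congr andb.
rewrite eval_FAnd eval_FNot (@eval_FIn _ _ _ _ v s) //; congr andb.
rewrite exists_edge eval_FExE; apply: has_edges => q t _ _ qt.
rewrite eval_FAnd (@eval_FIn _ _ _ _ v t) //; congr andb.
rewrite eval_FAnd !eval_FNot (@eval_FIn _ _ _ _ u t) //; congr (_ && ~~ _).
rewrite exists_edge eval_FExE; apply: has_edges => o w _ _ ow.
rewrite eval_FNot eval_FExIn ow has_map.
have outE x : eval r 6 (upd (upd (upd (upd env 2 p) 3 q) 4 o) 5 (code x))
    outside_form = (x \notin ([set:: s] :|: [set:: t]) :\: [set u; v]).
  rewrite /outside_form !eval_FOr eval_FAnd !eval_FNot.
  rewrite (@eval_FIn _ _ _ _ x s) // (@eval_FIn _ _ _ _ x t) //.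
  rewrite /= [upd _ _ _ 0]env0 [upd _ _ _ 1]env1 !(inj_eq code_inj) !inE.
  by rewrite negb_and negbK negb_or orbA.
rewrite (eq_has outE) -all_predC; apply/allP/subsetP => sub x.
  by rewrite in_set => /sub/negPn.
by move=> xw; apply/negPn/sub; rewrite in_set.
Qed.

(** * Conditions (a) and (b) evaluated with the table of nearness *)

Section Matrix.
Hypothesis r_near : forall u v,
  (r (code u * #|V| + code v + size (encode num es)) == 1) = near E u v.

Lemma eval_FNear d env x y u v : env x = code u -> env y = code v ->
  eval r d env (FNear x y) = near E u v.
Proof. by move=> xu yv; rewrite /= xu yv input0 input_endE r_near. Qed.

Lemma eval_hit_body k env p s (xs : k.-tuple V) :
  entries r p = map code s -> env 0 = p ->
  (forall i : 'I_k, env i.+1 = code (tnth xs i)) ->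
  eval r k.+1 env
    (FAnd (FNears [seq (i, j) | i <- iota 1 k, j <- iota 1 k])
          (FNot (FExIn 0 (FNears [seq (k.+1, i) | i <- iota 1 k]))))
  = all (fun x => all (near E x) xs) xs &&
    ~~ has (fun v => all (near E v) xs) s.
Proof.
move=> ps env0 envS; rewrite eval_FAnd eval_FNot eval_FExIn env0 ps has_map.
have iotaP i : i \in iota 1 k -> exists j : 'I_k, i = j.+1.
  rewrite mem_iota => /andP[i0 i_k]; have i_k' : i.-1 < k by lia.
  by exists (Ordinal i_k'); rewrite /= prednK.
have memS (j : 'I_k) : j.+1 \in iota 1 k.
  by rewrite mem_iota; have := ltn_ord j; lia.
congr (_ && ~~ _).
  rewrite eval_FNears; apply/allP/allP => [H x /tnthP[i ->]|H [i j]].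
    apply/allP => y /tnthP[j ->].
    rewrite -(@eval_FNear k.+1 env i.+1 j.+1) ?envS //.
    exact: (H (i.+1 : nat, j.+1 : nat) (allpairs_f _ _ _)).
  move=> /allpairsP[[i' j'] /= [/iotaP[a ->] /iotaP[b ->] [-> ->]]].
  have := H _ (mem_tnth a xs) => /allP/(_ _ (mem_tnth b xs)) nearab.
  exact: etrans (@eval_FNear k.+1 env _ _ _ _ (envS a) (envS b)) nearab.
apply: eq_has => v; rewrite /preim /= eval_FNears.
set env' := upd _ _ _; have env'v : env' k.+1 = code v by exact: upd_eq.
have env'S (i : 'I_k) : env' i.+1 = code (tnth xs i).
  by rewrite /env' upd_neq ?envS //; have := ltn_ord i; lia.
apply/allP/allP => [H x /tnthP[i ->]|H _ /mapP[_ /iotaP[i ->] ->]].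
  rewrite -(@eval_FNear k.+2 env' k.+1 i.+1) //.
  exact: (H (k.+1, i.+1 : nat) (map_f _ (memS i))).
exact: etrans (@eval_FNear k.+2 env' _ _ _ _ env'v (env'S i)) (H _ (mem_tnth i xs)).
Qed.

Lemma eval_hit_form k env : eval r 0 env (hit_form k) =
  ~~ [exists e in E, [exists xs : k.-tuple V,
        all (fun x => all (near E x) xs) xs &&
        [forall v in e, ~~ all (near E v) xs]]].
Proof.
rewrite eval_FNot eval_FExE exists_edge; congr negb.
apply: has_edges => p s _ _ ps.
have tb := typed_hit_form k; rewrite /= typed_iter_FExV in tb.
have sE xs : [forall v in [set:: s], ~~ all (near E v) xs] =
             ~~ has (fun v => all (near E v) xs) s.
  rewrite -all_predC; apply/forall_inP/allP => H v; last by rewrite in_set => /H.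
  by move=> vs; apply: H; rewrite in_set.
apply/(eval_iter_FExV _ _ tb)/existsP => [[env' [e0 lt_n ev]]|[xs]].
  (* Levels 1 to [k] hold numbers below |V|, which decode to a tuple of vertices. *)
  have onto (i : 'I_k) : exists v, code v == env' i.+1.
    have [|v <-] := @code_onto (env' i.+1); last by exists v.
    by rewrite -input0 lt_n //=; have := ltn_ord i; lia.
  pose xs := [tuple xchoose (onto i) | i < k].
  exists xs; rewrite sE -(@eval_hit_body k env' p) // => [|i].
    by rewrite e0.
  by rewrite tnth_mktuple (eqP (xchooseP (onto i))).
rewrite sE => H; pose env' i := if i is j.+1 then nth 0 (map code xs) j else p.
exists env'; split=> [[]//|[//|i] /= i_k|].
  have ik : i < k by lia.
  by rewrite (nth_map (tnth xs (Ordinal ik))) ?size_tuple // input0 ltn_ord.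
rewrite (@eval_hit_body k env' p s xs) // => i.
by rewrite /env' (nth_map (tnth xs i)) ?size_tuple // -tnth_nth.
Qed.

Lemma eval_private_form env : eval r 0 env private_form =
  [forall w, exists e in E, (w \in e) &&
     [forall x in e, near E w x ==> (x == w)]].
Proof.
rewrite /private_form eval_FNot [eval _ _ _ (FExV _)]/= has_vertices negb_exists.
apply: eq_forallb => w; rewrite -[~~ _ in LHS]/(~~ ~~ eval r 1 (upd env 0 (code w))
  (FExE (FAnd (FIn 2 0 1) (FNot (FExIn 1 (FAnd (FNot (FEq 2 0)) (FNear 0 2))))))).
rewrite negbK exists_edge eval_FExE; apply: has_edges => p s _ _ ps.
rewrite eval_FAnd (@eval_FIn _ _ _ _ w s) // eval_FNot eval_FExIn ps has_map.
have farE x : eval r 3 (upd (upd (upd env 0 (code w)) 1 p) 2 (code x))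
    (FAnd (FNot (FEq 2 0)) (FNear 0 2)) = ~~ (near E w x ==> (x == w)).
  rewrite eval_FAnd eval_FNot (@eval_FNear _ _ _ _ w x) //= !upd_eq.
  by rewrite (inj_eq code_inj) negb_imply andbC.
rewrite (eq_has farE) -all_predC; congr andb; apply/allP/forall_inP => H x.
  by rewrite in_set => /H/negPn.
by move=> xs; apply/negPn/H; rewrite in_set.
Qed.

Lemma eval_conformal k env : 0 < #|V| -> dimension E <= k ->
  eval r 0 env (FAnd (hit_form k) private_form) = conformal (dual_hypergraph E).
Proof.
move=> V0 dimE; rewrite eval_FAnd eval_hit_form eval_private_form.
apply/andP/(conformal_dualP V0 dimE) => [[/exists_inPn hit /forallP priv]|[hit priv]].
  split=> [e xs eE size_xs clxs|w].
    have xs_k : size xs == k by apply/eqP.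
    have := hit e eE; rewrite negb_exists => /forallP/(_ (Tuple xs_k)).
    rewrite negb_and /= => /orP[/negP[]|].
      by apply/allP => x xxs; apply/allP => y yxs; apply: clxs.
    rewrite negb_forall_in => /exists_inP[v ve]; rewrite negbK => /allP nv.
    by exists v.
  have /exists_inP[e eE /andP[we /forall_inP out]] := priv w.
  by exists e; split=> // x xe nx; apply/eqP/(implyP (out x xe)).
split.
  apply/exists_inPn => e eE; rewrite negb_exists; apply/forallP => xs.
  rewrite negb_and -implybE; apply/implyP => /allP clxs.
  have [||v ve nv] := hit e xs eE; rewrite ?size_tuple //.
    by move=> x y xxs yxs; move/allP: (clxs x xxs); apply.
  by rewrite negb_forall_in; apply/exists_inP; exists v; rewrite // negbK; apply/allP.
apply/forallP => w; have [e [eE we out]] := priv w.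
apply/exists_inP; exists e; rewrite // we; apply/forall_inP => x xe.
by apply/implyP => nx; apply/eqP/out.
Qed.

End Matrix.
(** The listed sets are distinct, so counting positions of the list counts hyperedges. *)
Lemma sum_incidence u : \sum_(s <- es) (u \in [set:: s] : nat) = degree E u.
Proof.
case: esE => _ uniqE EE; transitivity (count (fun s => u \in [set:: s]) es).
  by rewrite -sum1_count [RHS]big_mkcond; apply: eq_bigr => s _; case: (_ \in _).
rewrite -(count_map (fun s => [set:: s]) (fun e => u \in e)) -size_filter.
rewrite -(card_uniqP (filter_uniq _ uniqE)); apply: eq_card => e.
by rewrite mem_filter inE EE andbC.
Qed.

Lemma card_edges : #|E| = size es.
Proof.
case: esE => _ uniqE EE.
by rewrite (eq_card EE) (card_uniqP uniqE) size_map.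
Qed.

Lemma size_edge k s : dimension E <= k -> s \in es -> size s <= k.
Proof.
move=> dimE s_es; case: esE => /allP uniq_es _ EE.
have -> : size s = #|[set:: s]|.
  by rewrite -(card_uniqP (uniq_es s s_es)); apply: eq_card => v; rewrite in_set.
apply: leq_trans dimE; apply: (leq_bigmax_cond (F := fun e : {set V} => #|e|)).
by rewrite EE map_f.
Qed.

(** * The cost of testing nearness of one pair *)

Section Cost.
Variable k : nat.
Hypothesis dimE : dimension E <= k.
Local Notation m := #|E|.
Local Notation D := (max_degree E).

Lemma edge_ptr_le p : p \in edge_ptrs r -> r p <= k.
Proof.
move=> pE; have : entries r p \in map (map code) es by rewrite -input_edges map_f.
case/mapP => s s_es /(congr1 size); rewrite !size_map size_iota => ->.
exact: size_edge.
Qed.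

(** Each of at most [k] vertices costs 2 for the comparison and 6 for the loop. *)
Lemma cost_FIn d env x e : x < d -> e < d -> env e \in edge_ptrs r ->
  cost r d env (FIn d x e) <= 8 * k + 5.
Proof.
move=> x_d e_d /edge_ptr_le le_k; rewrite /= leq_add2r.
rewrite (leq_trans (leq_sum_const (c := 8) _)) //.
by rewrite size_map size_iota mulnC leq_mul2l le_k.
Qed.

(** Every hyperedge pays for the membership test, but only those containing [u], at most [D] of
    them, pay for [g]. *)
Lemma cost_incident d env x u g B : x < d -> env x = code u ->
  (forall p, p \in edge_ptrs r -> cost r d.+1 (upd env d p) g <= B) ->
  cost r d env (FExE (FAnd (FIn d.+1 x d) g)) <= m * (8 * k + 13) + D * B + 5.
Proof.
move=> x_d xu le_B; rewrite cost_FExE leq_add2r.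
apply: (@leq_trans (\sum_(s <- es) (8 * k + 13 + (u \in [set:: s]) * B))).
  apply: leq_sum_map_eq input_edges _ => p s pE _ ps.
  rewrite cost_FAnd (@eval_FIn _ _ _ _ u s); last 4 first.
  - by lia.
  - by [].
  - by rewrite upd_neq //; lia.
  - by rewrite upd_eq.
  have := @cost_FIn d.+1 (upd env d p) x d; rewrite upd_eq => /(_ _ _ pE).
  move=> /(_ (ltnW x_d) (ltnSn d)) le_in.
  have : (u \in [set:: s]) * cost r d.+1 (upd env d p) g <= (u \in [set:: s]) * B.
    by rewrite leq_mul2l le_B // orbT.
  by lia.
rewrite big_split /= -big_distrl /= sum_incidence.
apply: leq_add; first by rewrite card_edges; apply: leq_sum_const.
by rewrite leq_mul2r (leq_bigmax (F := degree E)) orbT.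
Qed.

(** The zeros are harmless: this subformula loops over vertices of hyperedges only. *)
Definition near_cost : nat :=
  cost_bound 0 0 k (FNot (FExIn 4 outside_form)) + 32 * k + 90.

(** [cost_incident] at [u] and then at [v] leaves at most [D ^ 2] pairs of hyperedges, each followed
    by one scan of all [m] hyperedges. *)
Lemma cost_near_form env u v : 0 < m -> 0 < D ->
  env 0 = code u -> env 1 = code v ->
  cost r 2 env near_form <= near_cost * (m * D ^ 2).
Proof.
move=> m0 D0 env0 env1; rewrite /near_form.
set F := FExE (FAnd (FIn 3 0 2) _).
have : cost r 2 env (FOr (FEq 0 1) F) <= cost r 2 env F + 10.
  by rewrite /FOr /=; case: (_ == _); rewrite /= ?mul1n ?mul0n; lia.
move=> /leq_trans; apply.
pose c := cost_bound 0 0 k (FNot (FExIn 4 outside_form)) + 6.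
(* [B3] and [B2] bound what remains to be tested once v is known to lie in f, respectively u in
   e. *)
pose B3 := 8 * k + 16 + m * c.
pose B2 := 8 * k + 14 + m * (8 * k + 13) + D * B3.
have le2 : cost r 2 env F <= m * (8 * k + 13) + D * B2 + 5.
  apply: (@cost_incident _ _ _ u) => // p pE; set env2 := upd env 2 p.
  set G := FExE _.
  have le3 : cost r 3 env2 G <= m * (8 * k + 13) + D * B3 + 5.
    apply: (@cost_incident _ _ _ v) => // q qE; set env3 := upd env2 3 q.
    set H := FNot (FExE _).
    have le4 : cost r 4 env3 H <= m * c + 7.
      have := @cost_le r k H [:: false; false; true; true] env3 isT.
      rewrite /edges_le input0 input1 -card_edges => /(_ _ edge_ptr_le) le4.
      apply: leq_trans (le4 _) _; last by rewrite /c /=; lia.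
      case=> [|[|[|[|i]]]] //=; rewrite ?nth_nil // => _; exact: edge_ptr_le.
    have := @cost_FIn 4 env3 0 3 isT isT qE.
    rewrite cost_FAnd [cost _ _ _ (FNot (FIn _ _ _))]cost_FNot /B3.
    by case: (eval _ _ _ _); rewrite ?mul1n ?mul0n; lia.
  have := @cost_FIn 3 env2 1 2 isT isT pE.
  rewrite cost_FAnd [cost _ _ _ (FNot (FIn _ _ _))]cost_FNot /B2.
  by case: (eval _ _ _ _); rewrite ?mul1n ?mul0n; lia.
rewrite /near_cost; move: le2; rewrite /B2 /B3 /c; move: (cost_bound _ _ _ _) => C.
by move: (cost _ _ _ _) => T; nia.
Qed.

End Cost.
End Input.

(** * The algorithm *)

(** Register 3 walks over the hyperedges to the end of the input while register 4 counts up to |E|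
    in register 5. *)
Definition init_prog : prog :=
  Seq (Const 1 1) (Seq (Fetch 2 0) (Seq (Fetch 5 1) (Seq (Const 3 2)
 (Seq (Const 4 0)
 (While (Lt 4 5)
    (Seq (Fetch 6 3) (Seq (Op Add 3 3 6)
    (Seq (Op Add 3 3 1) (Op Add 4 4 1))))))))).

(** The loop counters 4 and 7 are [var 0] and [var 1], the free variables of [near_form]; 10 is
    [var 2], free again for the address of the cell. *)
Definition matrix_prog : prog :=
  Seq (Const 4 0)
 (While (Lt 4 2)
    (Seq (Seq (Const 7 0)
         (While (Lt 7 2)
            (Seq (compile 2 near_form)
            (Seq (Op Mul 10 4 2) (Seq (Op Add 10 10 7) (Seq (Op Add 10 10 3)
            (Seq (Store 10 0) (Op Add 7 7 1))))))))
         (Op Add 4 4 1))).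

Definition main_prog k : prog :=
  Seq init_prog (Seq matrix_prog (compile 0 (FAnd (hit_form k) private_form))).

Lemma init_runs W N r s : (forall i, r i <= N) -> input_end r <= N ->
  N * N + 3 * N + 3 < W -> ram s = r -> reg s = (fun=> 0) ->
  runs W init_prog s (5 + ((r 1) * 5).+1) (frame r).
Proof.
move=> r_le end_le ltW rm r0; have p_lt := @next_iter_lt r.
pose I i s' := [/\ reg s' 1 = 1, reg s' 2 = r 0, reg s' 5 = r 1,
  reg s' 4 = i /\ reg s' 3 = iter i (next_edge r) 2 & ram s' = r].
apply: (@runs_weaken _ _ _ (1 + (1 + (1 + (1 + (1 +
  (\sum_(0 <= i < r 1) 5).+1))))) _ (I (r 1))).
- apply: runs_seq; apply: runs_const; first lia.
  apply: runs_seq; apply: runs_fetch.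
  apply: runs_seq; apply: runs_fetch.
  apply: runs_seq; apply: runs_const; first lia.
  apply: runs_seq; apply: runs_const; first lia.
  apply: (@runs_while _ _ _ I (r 1) (fun=> 4)) => //.
  + by move=> i s' i_m [_ _ r5 [r4 _] _]; rewrite /= r4 r5.
  + move=> i s' i_m [r1 r2 r5 [r4 r3] rm'].
    have end_i : iter i.+1 (next_edge r) 2 <= N.
      apply: leq_trans end_le; rewrite /input_end.
      by have [->|ne] := eqVneq i.+1 (r 1); rewrite // ltnW // p_lt; lia.
    have := r_le 1 => m_N; rewrite iterS /next_edge -/(next_edge r) in end_i.
    apply: (@runs_slack _ (1 + (1 + (1 + 1)))) => //.
    apply: runs_seq; apply: runs_fetch; rewrite r3 rm'.
    apply: runs_seq; apply: runs_op; rewrite /= /upd /= r3; first lia.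
    apply: runs_seq; apply: runs_op; rewrite /= /upd /= r1; first lia.
    apply: runs_op; rewrite /= /upd /= r4 r1; first lia.
    exists i.+1; split=> //; split=> //; split; rewrite /= /upd /= ?addn1 //.
    by rewrite /next_edge; lia.
  + by move=> s' [_ _ r5 [r4 _] _]; rewrite /= r4 r5 ltnn.
  + by split; rewrite //= ?r0 ?rm.
- by rewrite big_const_nat iter_addn_0 subn0; lia.
- by move=> s' [r1 r2 _ [_ r3] rm'].
Qed.

(** In row-major order, a lexicographically earlier pair has a smaller address. *)
Lemma cell_neq N n i j u v : v < n -> (u < i) || (u == i) && (v < j) ->
  N + u * n + v != i * n + j + N.
Proof.
move=> v_n /orP[u_i|/andP[/eqP-> v_j]]; last by lia.
have : u * n + n <= i * n by rewrite -mulSnr leq_mul2r u_i orbT.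
by lia.
Qed.

(** * Filling the table of nearness *)

Section Matrix.
Variables (V : finType) (num : V -> 'I_#|V|) (E : {set {set V}}).
Variables (es : seq (seq V)) (k W : nat).
Hypotheses (num_inj : injective num) (esE : edge_list E es).
Hypotheses (dimE : dimension E <= k) (E0 : 0 < #|E|) (D0 : 0 < max_degree E).
Let N := size (encode num es).
Hypotheses (ltW : N * N + 3 * N + 3 < W) (V_N : #|V| <= N) (N0 : 0 < N).
Let code v : nat := num v.

(** The bound concerns all of memory, as [compile_runs] demands; table entries, being 0 or 1,
    respect it. *)
Definition holds_input (r : nat -> nat) : Prop :=
  (forall i, i < N -> r i = nth 0 (encode num es) i) /\ forall i, r i <= N.

Definition filled i j (r : nat -> nat) : Prop :=
  forall u v, (code u < i) || (code u == i) && (code v < j) ->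
    r (N + code u * #|V| + code v) = near E u v.

Definition phase i (s : state) : Prop :=
  exists r, [/\ holds_input r, frame r s, filled i 0 r & reg s 4 = i].

Lemma matrix_runs r s : holds_input r -> frame r s ->
  runs W matrix_prog s
    (#|V| * (#|V| * (near_cost k * (#|E| * max_degree E ^ 2) + 6) + 4) + 2)
    (phase #|V|).
Proof.
move=> inp fr; pose T := near_cost k * (#|E| * max_degree E ^ 2).
apply: (@runs_weaken _ _ _
  (1 + (\sum_(0 <= i < #|V|) (1 + (\sum_(0 <= j < #|V|) (T + 5).+1).+1 + 1).+1).+1)
  _ (phase #|V|)) => //; last first.
  by rewrite !sum_nat_const_nat !subn0 -/T; nia.
apply: runs_seq; apply: runs_const; first lia.
apply: (@runs_while _ _ _ phase #|V|
  (fun=> 1 + (\sum_(0 <= j < #|V|) (T + 5).+1).+1 + 1)) => //.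
- move=> i s' i_n [r' [[inp' _] [_ r2 _ _] _ r4]].
  by rewrite /= r2 r4 (input0 inp').
- move=> i s1 i_n [r1 [inp1 fr1 fill1 r14]].
  pose J j s' := exists r', [/\ holds_input r', frame r' s', filled i j r',
    reg s' 4 = i & reg s' 7 = j].
  apply: runs_seq.
  apply: (@runs_weaken _ _ _ (1 + (\sum_(0 <= j < #|V|) (T + 5).+1).+1)
    _ (J #|V|)) => //; last first.
    move=> s2 [r2 [inp2 [rg1 rg2 rg3 rm2] fill2 r24 r27]].
    apply: runs_op; rewrite /= /upd /= r24 rg1; first lia.
    exists i.+1; split=> //; exists r2; split=> //; last by rewrite /= upd_eq addn1.
    (* A row filled up to column |V| is complete, so the next row starts at column 0. *)
    move=> u v; rewrite ltn0 andbF orbF ltnS leq_eqVlt => uv; apply: fill2.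
    by rewrite ltn_ord andbT orbC.
  apply: runs_seq; apply: runs_const; first lia.
  apply: (@runs_while _ _ _ J #|V| (fun=> T + 5)) => //.
  + move=> j s' j_n [r' [[inp' _] [_ r2 _ _] _ _ r7]].
    by rewrite /= r2 r7 (input0 inp').
  + move=> j s2 j_n [r2 [[inp2 le2] fr2 fill2 r24 r27]].
    have [u uE] := code_onto num_inj i_n; have [v vE] := code_onto num_inj j_n.
    pose env x := if x is 0 then i else j.
    have ag : agree N 2 env s2 by case=> [|[|x]] // _; split=> //=; lia.
    have le_end : input_end r2 <= N by rewrite (input_endE inp2).
    have run := @compile_runs N r2 W le2 le_end ltW near_form [:: false; false]
      env s2 isT fr2 ag.
    have le_T : cost r2 2 env near_form <= T.
      exact: (@cost_near_form _ _ _ _ _ num_inj esE inp2 k dimE env u v).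
    rewrite [eval _ _ _ _](@eval_near_form _ _ _ _ _ num_inj esE inp2 env u v)
      // in run.
    apply: (@runs_slack _ (T + (1 + (1 + (1 + (1 + 1)))))) => //.
    apply: runs_seq; apply: runs_weaken run le_T _ => s3 [r30 k3].
    have [rg1 rg2 rg3 rm3] := keeps_frame k3 fr2.
    have r34 : reg s3 4 = i by have [_ ->] := k3.
    have r37 : reg s3 7 = j by have [_ ->] := k3.
    rewrite (input_endE inp2) -/N in rg3.
    have [n nE] : exists n, n = #|V| by exists #|V|.
    have {}rg2 : reg s3 2 = n by rewrite rg2 (input0 inp2) nE.
    have j_n' : j < n by rewrite nE.
    have i_n' : i < n by rewrite nE.
    have n_N : n <= N by rewrite nE.
    have ijn : i * n + n <= N * N by nia.
    apply: runs_seq; apply: runs_op; rewrite /= /upd /= r34 rg2; first lia.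
    apply: runs_seq; apply: runs_op; rewrite /= /upd /= r37; first lia.
    apply: runs_seq; apply: runs_op; rewrite /= /upd /= rg3; first lia.
    apply: runs_seq; apply: runs_store.
    apply: runs_op; rewrite /= /upd /= r37 rg1; first lia.
    subst n; exists j.+1; split=> //.
    (* The cell written lies at address at least [N], so the input survives. *)
    exists (upd r2 (i * #|V| + j + N) (near E u v)).
    split=> //=; last by rewrite upd_eq addn1.
    * split=> x; first by move=> x_N; rewrite upd_neq ?inp2 //; lia.
      by rewrite /upd; case: eqP => // _; case: near.
    * have inp3 : forall x, x < N ->
          upd r2 (i * #|V| + j + N) (near E u v) x = nth 0 (encode num es) x.
        by move=> x x_N; rewrite upd_neq ?inp2 //; lia.
      split=> //=; first by rewrite (input0 inp3).
        by rewrite (input_endE inp3).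
      by rewrite rm3 r30.
    * move=> u' v'; rewrite ltnS leq_eqVlt => uv'.
      have lt_u' : code u' < #|V| by exact: ltn_ord.
      have lt_v' : code v' < #|V| by exact: ltn_ord.
      have [/andP[/eqP u'i /eqP v'j]|ne] :=
        boolP ((code u' == i) && (code v' == j)).
        rewrite u'i v'j [N + _]addnC addnAC upd_eq.
        have -> : u' = u by apply: (code_inj num_inj); rewrite uE.
        by have -> : v' = v by apply: (code_inj num_inj); rewrite vE.
      rewrite upd_neq; first by apply: fill2; lia.
      by apply: cell_neq lt_v' _; lia.
  + move=> s' [r' [[inp' _] [_ r2 _ _] _ _ r7]].
    by rewrite /= r2 r7 (input0 inp') ltnn.
  + by exists r1; split=> //=; case: fr1.
- move=> s' [r' [[inp' _] [_ r2 _ _] _ r4]].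
  by rewrite /= r2 r4 (input0 inp') ltnn.
- exists r; split=> //.
  by move=> u v; rewrite !ltn0 andbF.
Qed.

End Matrix.

(** * Adding up the costs *)

Definition hit_cost k : nat := cost_bound 0 0 k
  (FAnd (FNears [seq (i, j) | i <- iota 1 k, j <- iota 1 k])
        (FNot (FExIn 0 (FNears [seq (k.+1, i) | i <- iota 1 k])))) + k * 11.

Lemma cost_bound_FNears n m k ps :
  cost_bound n m k (FNears ps) = cost_bound 0 0 k (FNears ps).
Proof. by elim: ps => //= p ps ->. Qed.

(** Condition (a) accounts for [m * n ^ k]; condition (b) costs O([n * m * k]), which the first term
    absorbs. *)
Lemma cost_decision_form n m k D : 0 < n -> 0 < m -> 0 < D ->
  cost_bound n m k (FAnd (hit_form k) private_form)
    <= (hit_cost k + 30 * k + 100) * (m * n ^ 2 * D ^ 2 + m * n ^ k).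
Proof.
move=> n0 m0 D0; rewrite /hit_form; set B := FAnd (FNears _) (FNot _).
have body : cost_bound n m k B = cost_bound 0 0 k B.
  by rewrite /= !cost_bound_FNears.
have le_iter := cost_bound_iter_FExV m k B k n0.
rewrite body -/(hit_cost k) in le_iter.
have P0 : 0 < n ^ k by rewrite expn_gt0 n0.
rewrite [cost_bound _ _ _ (FAnd _ _)]/= -/B.
move: le_iter P0; set T := cost_bound _ _ _ (iter _ _ _); move: (n ^ k) (hit_cost k).
move=> P H le_T P0.
have : m * T <= m * (H * P) by rewrite leq_mul2l le_T orbT.
have : m <= m * P by apply: leq_pmulr.
have nm_le : n * m <= m * n ^ 2 * D ^ 2.
  have : n * m <= n * m * (n * (D * D)) by rewrite leq_pmulr // !muln_gt0 n0 D0.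
  by rewrite -!mulnn; lia.
have n_le : n <= n * m by apply: leq_pmulr.
move: nm_le; move: (m * n ^ 2 * D ^ 2) => X nm_le.
have : n * m * k <= X * k by rewrite leq_mul2r nm_le orbT.
by rewrite /=; nia.
Qed.

Lemma total_cost n m D A B F S : 0 < n -> 0 < m -> 0 < D ->
  m * n ^ 2 * D ^ 2 <= S -> F <= B * S ->
  5 + (m * 5).+1 + (n * (n * (A * (m * D ^ 2) + 6) + 4) + 2 + F)
    <= (A + B + 30) * S.
Proof.
move=> n0 m0 D0 leS leF; set M := m * n ^ 2 * D ^ 2 in leS.
have n2 : n * n <= M.
  by rewrite /M mulnn mulnAC leq_pmull // muln_gt0 m0 expn_gt0 D0.
have n1 : n <= n * n by apply: leq_pmulr.
have m1 : m <= M by rewrite /M -mulnA leq_pmulr // muln_gt0 !expn_gt0 n0 D0.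
have AM : n * n * (A * (m * D ^ 2)) <= A * S.
  suff -> : n * n * (A * (m * D ^ 2)) = A * M by rewrite leq_mul2l leS orbT.
  by rewrite /M -mulnn; lia.
by move: leS n2 m1 AM; move: M (A * (m * D ^ 2)) => M X; lia.
Qed.

Theorem theorem5p3 (k : nat) (hk : 0 < k) :
  exists (p : prog) (C c : nat),
    forall (V : finType) (num : V -> 'I_#|V|) (E : {set {set V}})
           (es : seq (seq V)),
      injective num -> is_hypergraph E -> dimension E <= k ->
      edge_list E es ->
      decides p c (encode num es) (conformal (dual_hypergraph E))
        (C * (#|E| * #|V| ^ 2 * max_degree E ^ 2 + #|E| * #|V| ^ k)).
Proof.
(* The constant adds up those of [total_cost] and [cost_decision_form]. *)
exists (main_prog k), (30 + near_cost k + hit_cost k + 30 * k + 100), 3.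
move=> V num E es num_inj /andP[V0 /eqP covE] dimE esE.
set inp := encode num es; set N := size inp.
(* A vertex and a hyperedge through it make |E| and Delta positive, so lower-order terms can be
   absorbed. *)
have [x0 _] : exists x0 : V, x0 \in V by apply/card_gt0P.
have [e0 e0E x0e0] : exists2 e, e \in E & x0 \in e.
  by have := in_setT x0; rewrite -covE => /bigcupP[e]; exists e.
have E0 : 0 < #|E| by apply/card_gt0P; exists e0.
have D0 : 0 < max_degree E.
  apply: leq_trans (leq_bigmax (F := degree E) x0).
  by apply/card_gt0P; exists e0; rewrite inE e0E.
have [/allP uniq_es uniqE EE] := esE.
have flat_le : size (flatten es) + size es + 2 = N.
  rewrite /N /= addn2; congr _.+2; rewrite !size_flatten /shape -!map_comp.
  by elim: (es) => //= s l <-; rewrite size_map; lia.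
(* Every vertex occurs in some listed hyperedge, so |V| is bounded by the input length. *)
have V_N : #|V| <= size (flatten es).
  rewrite cardE; apply: uniq_leq_size (enum_uniq _) _ => v _.
  have := in_setT v; rewrite -covE => /bigcupP[e]; rewrite EE => /mapP[s s_es ->].
  by rewrite in_set => vs; apply/flattenP; exists s.
have V_N' : #|V| <= N by apply: leq_trans V_N _; lia.
have es0 : 0 < size es by rewrite -(card_edges esE).
have inp_le x : x \in inp -> x <= N.
  rewrite /inp !inE => /or3P[/eqP->//|/eqP->|/flattenP[_ /mapP[s s_es ->]]].
    by lia.
  rewrite inE => /orP[/eqP->|/mapP[v _ ->]].
    by rewrite -(card_uniqP (uniq_es s s_es)) (leq_trans (max_card _)).
  exact: leq_trans (ltnW (ltn_ord _)) V_N'.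
(* Here [N] is at least 4: two header words, a size and a vertex. *)
have ltW : N * N + 3 * N + 3 < N ^ 3 by rewrite !expnS expn0; nia.
have inp_ok : holds_input num es (nth 0 inp).
  split=> // i; case: (ltnP i N) => [i_N|N_i]; first by rewrite inp_le ?mem_nth.
  by rewrite nth_default.
have end_le : input_end (nth 0 inp) <= N.
  by rewrite (@input_endE _ num es).
have N0 : 0 < N by lia.
have init : runs (N ^ 3) (main_prog k) (init_state inp)
    ((5 + (size es * 5).+1) +
     (#|V| * (#|V| * (near_cost k * (#|E| * max_degree E ^ 2) + 6) + 4) + 2
     + cost_bound #|V| #|E| k (FAnd (hit_form k) private_form)))
    (fun s => reg s 0 = conformal (dual_hypergraph E)).
  apply: runs_seq.
  have run := @init_runs _ N (nth 0 inp) (init_state inp) inp_ok.2 end_le ltW.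
  apply: runs_weaken (run _ _) _ _ => //.
  move=> s1 fr1; apply: runs_seq.
  have fill := matrix_runs num_inj esE dimE E0 D0 ltW V_N' N0 inp_ok fr1.
  apply: runs_weaken fill _ _ => //.
  move=> s2 [r [[inp2 le2] fr2 fill2 _]].
  have end2 : input_end r <= N by rewrite (input_endE inp2).
  have typed0 : typed [::] (FAnd (hit_form k) private_form).
    by apply/andP; split; first exact: typed_hit_form.
  have ag : agree N 0 (fun=> 0) s2 by [].
  apply: runs_weaken (compile_runs le2 end2 ltW typed0 fr2 ag) _ _.
    have := @cost_le r k _ [::] (fun=> 0) typed0.
    rewrite (input0 inp2) (input1 inp2) -(card_edges esE); apply=> [i|p].
      by rewrite nth_nil.
    exact: (edge_ptr_le esE inp2 dimE).
  move=> s3 [-> _]; rewrite (eval_conformal num_inj esE inp2) // => u v.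
  have := fill2 u v; rewrite ltn_ord /= => /(_ isT).
  by rewrite [N + _]addnC addnAC => ->; case: near.
have [t [s [ex le_t ans]]] := init; exists t, s; split=> //.
apply: leq_trans le_t _; have := cost_decision_form k V0 E0 D0.
rewrite -(card_edges esE); set F := cost_bound _ _ _ _ => leF.
set S := _ + #|E| * #|V| ^ k in leF *.
apply: leq_trans (total_cost (near_cost k) V0 E0 D0 (leq_addr _ _) leF) _.
by rewrite leq_mul2r; apply/orP; right; lia.
Qed.
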